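(* Assume Baumgartner's Axiom $\mathsf{BA}$. If $K$ is a separable compact line of weight $\omega_1$, then the Banach space $C(K)$ is isomorphic to the direct sum $C(K)\oplus C(K)$.
   Context: A subset $A$ of a topological space $X$ is $\omega_1$-dense in $X$ if $|U\cap A|=\omega_1$ for every nonempty open $U\subseteq X$. Baumgartner's Axiom $\mathsf{BA}$ (also denoted $\mathsf{BA}(\omega_1)$) is the statement: every two sets of reals that are $\omega_1$-dense in $\mathbb{R}$ are order isomorphic. A separable compact line is a linearly ordered set whose order topology is compact and separable. For a compact space $K$, $C(K)$ is the Banach space of continuous real-valued functions on $K$ with the supremum norm. Banach spaces are isomorphic if there is a bounded linear bijection between them with bounded inverse. The weight of a space is the least cardinality of a base of its topology. *)

(* Defs.v *)
From HB Require Import structures.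
From mathcomp Require Import all_boot all_order all_algebra.
From mathcomp Require Import all_classical all_reals all_analysis.
From mathcomp Require wochoice.
From mathcomp Require Import ring lra.

Set Implicit Arguments.
Unset Strict Implicit.
Unset Printing Implicit Defensive.

Import Order.TTheory GRing.Theory Num.Theory.
Import numFieldNormedType.Exports.

Local Open Scope classical_set_scope.
Local Open Scope ring_scope.
Local Open Scope card_scope.

(** [card_omega1 A]: the set [A] has cardinality omega_1. Mathcomp has no
    ordinals, so the bijection between [A] and omega_1 (the first uncountable
    ordinal) is expressed by transporting the order of omega_1 to [A]: some
    relation well-orders [A] in an order type that is uncountable and all of
    whose proper initial segments (taken here with their endpoint) are
    countable. *)
Definition card_omega1 (T : Type) (A : set T) : Prop :=
  ~ countable A /\
  exists r : rel T, wochoice.wo_chain r (mem A) /\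
    forall x, A x -> countable [set y | A y /\ r y x].

Definition omega1_dense (X : topologicalType) (A : set X) : Prop :=
  forall U : set X, open U -> U !=set0 -> card_omega1 (U `&` A).

Definition order_isomorphic d d' (X : porderType d) (Y : porderType d')
    (A : set X) (B : set Y) : Prop :=
  exists f : X -> Y,
    set_bij A B f /\ {in A &, {mono f : x y / (x <= y)%O}}.

Definition Baumgartner_axiom (R : realType) : Prop :=
  forall A B : set R, omega1_dense A -> omega1_dense B -> order_isomorphic A B.

Definition separable (X : topologicalType) : Prop :=
  exists D : set X, countable D /\ dense D.

Definition least_basis (X : topologicalType) (B : set (set X)) : Prop :=
  basis B /\ forall B' : set (set X), basis B' -> B #<= B'.

Definition weight_omega1 (X : topologicalType) : Prop :=
  exists B : set (set X), least_basis B /\ card_omega1 B.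

Section ContinuousPred.
Context {R : realType} {K : topologicalType}.

Definition contfun : {pred K -> R^o} := mem [set f : K -> R^o | continuous f].

Lemma contfunP (f : K -> R^o) : reflect (continuous f) (f \in contfun).
Proof.
by apply: (iffP idP) => [|cf]; [exact: set_mem|rewrite in_setE].
Qed.

Lemma contfun_submod_closed : submod_closed contfun.
Proof.
split; first by apply/contfunP; exact: cst_continuous.
move=> a f g /contfunP cf /contfunP cg; apply/contfunP => x.
by apply: continuousD; [apply: continuousZl_tmp; exact: cf|exact: cg].
Qed.

HB.instance Definition _ :=
  GRing.isSubmodClosed.Build _ _ contfun contfun_submod_closed.

End ContinuousPred.

Section SupNorm.
Context (R : realType) (K : topologicalType) (cK : compact [set: K]).

Record cfun := Cfun { cfun_val :> K -> R^o ; cfun_valP : cfun_val \in contfun }.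

HB.instance Definition _ := [isSub for cfun_val].
HB.instance Definition _ := gen_eqMixin cfun.
HB.instance Definition _ := gen_choiceMixin cfun.
HB.instance Definition _ := [SubChoice_isSubLmodule of cfun by <:].

Implicit Types f g : cfun.

Lemma cfun_continuous f : continuous (f : K -> R^o).
Proof. exact/contfunP/cfun_valP. Qed.

Definition supnorm f : R := sup (range (fun x : K => `|f x|)).

Lemma supnorm_ub f (x : K) : `|f x| <= supnorm f.
Proof.
apply: ub_le_sup; last by exists x.
have cf : {within [set: K], continuous (f : K -> R^o)}.
  by apply: continuous_subspaceT; exact: cfun_continuous.
have [M [_ bM]] := compact_bounded (continuous_compact cf cK).
by exists (M + 1) => _ [y _ <-]; apply: (bM (M + 1)); [rewrite ltrDl|exists y].
Qed.

Lemma supnorm_le f (M : R) : 0 <= M -> (forall x, `|f x| <= M) -> supnorm f <= M.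
Proof.
move=> M0 fM; have [x0|K0] := pselect (exists x : K, True).
  by apply: ge_sup => [|_ [y _ <-]//]; have [x _] := x0; exists `|f x|; exists x.
rewrite /supnorm (_ : [set _ | _ in _] = set0) ?sup0//.
by apply/seteqP; split => // z [y _ _]; case: K0; exists y.
Qed.

Lemma supnorm_ge0 f : 0 <= supnorm f.
Proof.
have [[x _]|K0] := pselect (exists x : K, True).
  exact: le_trans (supnorm_ub f x).
rewrite /supnorm (_ : [set _ | _ in _] = set0) ?sup0//.
by apply/seteqP; split => // z [y _ _]; case: K0; exists y.
Qed.

Lemma supnorm_triangle f g : supnorm (f + g) <= supnorm f + supnorm g.
Proof.
apply: supnorm_le => [|x]; first by rewrite addr_ge0 ?supnorm_ge0.
by rewrite (le_trans (ler_normD _ _))// lerD ?supnorm_ub.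
Qed.

Lemma supnormZ (a : R) f : supnorm (a *: f) = `|a| * supnorm f.
Proof.
have le_supnormZ b h : supnorm (b *: h) <= `|b| * supnorm h.
  apply: supnorm_le => [|x]; first by rewrite mulr_ge0 ?supnorm_ge0.
  have -> : (b *: h) x = b * h x by [].
  by rewrite normrM ler_wpM2l ?supnorm_ub.
apply/eqP; rewrite eq_le le_supnormZ/=.
have [->|a0] := eqVneq a 0; first by rewrite normr0 mul0r supnorm_ge0.
rewrite -ler_pdivlMl ?normr_gt0// -normfV.
by rewrite -[in leLHS](scalerK a0 f) le_supnormZ.
Qed.

Lemma supnorm0_eq0 f : supnorm f = 0 -> f = 0.
Proof.
move=> f0; apply: val_inj; apply/funext => x /=.
by apply/normr0_eq0/eqP; rewrite eq_le normr_ge0 -[leRHS]f0 supnorm_ub.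
Qed.

End SupNorm.

(** The Banach space C(K). The compactness proof is a parameter of the type
    because the supremum norm is a norm only on bounded functions. *)
Definition Cspace (R : realType) (K : topologicalType) (cK : compact [set: K]) : Type :=
  cfun R K.

Section SupNorm_instances.
Context (R : realType) (K : topologicalType) (cK : compact [set: K]).

HB.instance Definition _ := GRing.Lmodule.on (Cspace R cK).
HB.instance Definition _ := Lmodule_isNormed.Build R (Cspace R cK)
  (supnorm_triangle cK) (supnormZ cK) (@supnorm0_eq0 R K cK).

Let cauchy_unif (F : set_system (Cspace R cK)) : ProperFilter F -> cauchy F ->
  exists l : K -> R^o, forall e : R, 0 < e ->
    F [set h : Cspace R cK | forall x, `|l x - h x| <= e].
Proof.
move=> FF Fc.
have Fex e : 0 < e -> exists g : Cspace R cK,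
    F [set h : Cspace R cK | forall x, `|g x - h x| < e].
  move=> e0; have /cauchyP /(_ e e0) [g Fg] := Fc.
  exists g; apply: filterS Fg => h gh x; apply: le_lt_trans gh.
  exact: (supnorm_ub cK (g - h)).
have Fcvg x : cvg ((fun h : Cspace R cK => h x : R^o) @ F).
  apply: cauchy_cvg; apply/cauchy_exP => e e0.
  have [g Fg] := Fex e e0; exists (g x).
  by apply: (@filterS _ F _ _ _ _ Fg) => h gh; exact: gh.
exists (fun x => lim ((fun h : Cspace R cK => h x : R^o) @ F)) => e e0.
have e30 : 0 < e / 3 by rewrite divr_gt0.
have [g Fg] := Fex _ e30.
apply: filterS (Fg) => h gh x /=.
pose lx : R^o := lim ((fun h : Cspace R cK => h x : R^o) @ F).
have lF : F [set k : Cspace R cK | `|lx - k x| <= e / 3].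
  by have /cvgrPdist_le /(_ _ e30) := Fcvg x.
have [k [/(_ x)/ltW gk lk]] := filter_ex (filterI Fg lF).
rewrite -(subrKA (k x)) -(subrKA (g x) (k x)).
have -> : e = e / 3 + (e / 3 + e / 3) by field.
rewrite (le_trans (ler_normD _ _))// lerD// (le_trans (ler_normD _ _))//.
by rewrite lerD// ?(ltW (gh x))// distrC.
Qed.

Let Cspace_complete (F : set_system (Cspace R cK)) :
  ProperFilter F -> cauchy F -> cvg F.
Proof.
move=> FF /cauchy_unif[l Fl].
have cl : continuous l.
  move=> x; apply/cvgrPdist_le => e e0.
  have e30 : 0 < e / 3 by rewrite divr_gt0.
  have [h lh] := filter_ex (Fl _ e30).
  have /cvgrPdist_le /(_ _ e30) := @cfun_continuous R K h x.
  apply: filterS => y hxy.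
  rewrite -(subrKA (h x)) -(subrKA (h y) (h x)) (le_trans (ler_normD _ _))//.
  have -> : e = e / 3 + (e / 3 + e / 3) by field.
  rewrite lerD// (le_trans (ler_normD _ _))// lerD//.
  by rewrite distrC.
have lP : l \in contfun by exact/contfunP.
apply/cvg_ex; exists (Cfun lP : Cspace R cK).
apply/cvgrPdist_le => e e0; apply: filterS (Fl e e0) => h lh.
by apply: supnorm_le; first exact: ltW.
Qed.

HB.instance Definition _ :=
  Uniform_isComplete.Build (Cspace R cK) Cspace_complete.

End SupNorm_instances.

Definition banach_isomorphic (R : realType) (V W : normedModType R) : Prop :=
  exists (f : {linear V -> W}) (g : {linear W -> V}),
    [/\ cancel f g, cancel g f,
        exists M : R, forall x : V, `|f x| <= M * `|x| &
        exists M : R, forall y : W, `|g y| <= M * `|y|].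

(* Main.v *)
Require Import Defs.
From HB Require Import structures.
From mathcomp Require Import all_boot all_order all_algebra.
From mathcomp Require Import all_classical all_reals all_analysis.
From mathcomp Require wochoice.
From mathcomp Require Import ring lra zify.
Import Order.TTheory GRing.Theory Num.Theory.
Import numFieldNormedType.Exports.
Local Open Scope classical_set_scope.
Local Open Scope ring_scope.
Local Open Scope card_scope.
Set Implicit Arguments.
Unset Strict Implicit.
Unset Printing Implicit Defensive.

(** Why [C(K)] is isomorphic to its square.

    A jump of [K] is a pair [x < y] of adjacent points.  Since [K] is separable,
    having weight omega_1 means having omega_1 jumps.  Let [core] be the closed
    set of the points all of whose neighbourhoods contain uncountably many
    jumps.  Only countably many jumps of [K] have an endpoint outside [core]
    ([countable_jumps_touching_off_core]), the jumps of [core] separate its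
    points, and between two of them there are omega_1 others.  Embedding the
    jumps of [core] into the reals with a dense image ([rank], a binary search
    tree) makes them an omega_1-dense set of reals, so by Baumgartner's axiom
    they may be indexed by any other omega_1-dense set.  The index set
    [periodic] chosen here is invariant under integer translations and disjoint
    from a Cantor set ([core_chart]).

    Invariance under translation gives [core] order automorphisms [shift k],
    which carry the clopen piece between the jumps 0 and 1 onto the piece
    between the jumps k and k + 1; these pieces accumulate only at the two ends
    of [core].  Functions on [core] extend linearly and continuously to [K], by
    interpolation over the gaps ([ext]).  Consequently [C(K)] contains a
    complemented copy of the c_0-sum of countably many copies of the space [Y]
    of continuous functions on one piece: [analysis] reads the pieces of a
    function, [synthesis] glues pieces together, and [synthesis] is a right
    inverse of [analysis].

    The kernel of [analysis] consists of functions that are constant on each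
    half of [core]; they jump at countably many places only, hence are
    determined by a countable family of separating functions.  Milutin's
    averaging argument then makes this kernel complemented in [Y].  Points of
    [K] are located by a random walk down a binary tree of closed sets, and the
    expected value of a function along the walk ([mean]) depends continuously on
    the starting point.  A function of the kernel is transported to the
    piece by reading off the turns that a point of the piece takes in its own
    binary tree of jumps ([embed]); it is recovered by averaging over the branches
    that end in the Cantor set, on which every continuous function on the
    piece is uniformly continuous for the tree metric because no jump is indexed
    by a point of the Cantor set ([average_embed]).

    So [C(K) = c_0(Y) + V] with [V] complemented in [Y].  A shift of the
    coordinates absorbs [V]: [C(K)] is isomorphic to [c_0(Y)], which is isomorphic
    to its square by splitting sequences into even and odd terms
    ([banach_square]). *)

(** * Sets of cardinality omega_1 and countable sets *)

Lemma wo_chain_refl (T : Type) (r : rel T) (A : set T) (a : T) :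
  wochoice.wo_chain r (mem A) -> A a -> r a a.
Proof.
move=> rwo Aa; have [||z [[za zm] _]] := rwo (mem [set a]).
- by move=> x; rewrite !inE => ->.
- by exists a; rewrite inE.
- by have := zm a; rewrite inE => /(_ erefl); move: za; rewrite inE => ->.
Qed.

Lemma wo_chain_anti (T : Type) (r : rel T) (A : set T) (a b : T) :
  wochoice.wo_chain r (mem A) -> A a -> A b -> r a b -> r b a -> a = b.
Proof.
move=> rwo Aa Ab rab rba; have [||z [_ zu]] := rwo (mem [set a; b]).
- by move=> x; rewrite !inE => -[] ->.
- by exists a; rewrite inE; left.
- have raa := wo_chain_refl rwo Aa; have rbb := wo_chain_refl rwo Ab.
  rewrite -(zu a) ?(zu b)//; split; rewrite ?inE/=; [by right| |by left|];
    by move=> x; rewrite inE => -[] ->.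
Qed.

(** The set [B] is well ordered by choosing for each of its elements a preimage
    in [I * A] and comparing these lexicographically, first in the order of
    type omega_1 on [A] and then in [I].  A proper initial segment lies in the
    image of the product of [I] with an initial segment of [A], hence is
    countable. *)
Lemma card_omega1_image (I : countType) (T U : Type) (f : I -> T -> U)
    (A : set T) (B : set U) :
  card_omega1 A -> ~ countable B ->
  (forall u, B u -> exists i a, A a /\ f i a = u) -> card_omega1 B.
Proof.
move=> [_ [r [rwo rseg]]] nB fB; split => //.
have [u0 _] : exists u, B u.
  by apply: contrapT => B0; apply: nB; rewrite (_ : B = set0)//; apply/seteqP;
    split => // u Bu; apply: B0; exists u.
have [g gP] : exists g : U -> I * T,
    forall u, B u -> A (g u).2 /\ f (g u).1 (g u).2 = u.
  have [i [a _]] : exists i : I, exists a : T, True.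
    apply: contrapT => H; apply: nB; rewrite (_ : B = set0)//; apply/seteqP.
    by split => // u /fB[i [a _]]; apply: H; exists i, a.
  suff /choice[g gP] : forall u, exists ia : I * T,
      B u -> A ia.2 /\ f ia.1 ia.2 = u by exists g.
  move=> u; have [/fB[j [b jb]]|nBu] := pselect (B u); last by exists (i, a).
  by exists (j, b).
pose rB u v := if `[< (g u).2 = (g v).2 >]
  then (pickle (g u).1 <= pickle (g v).1)%N else r (g u).2 (g v).2.
have gA u : u \in B -> A (g u).2 by rewrite inE => /gP[].
exists rB; split.
- apply: wochoice.antisymmetric_wo_chain => [u v uB vB|S SB [s Ss]].
    rewrite /rB; case: (asboolP ((g u).2 = _)) => [e|ne].
      rewrite (asbool_equiv_eq (Q := True)); last by split => // _; exact: esym.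
      rewrite asboolT// -eqn_leq => /eqP/(pcan_inj pickleK) e1.
      have [_ <-] := gP u (set_mem uB); have [_ <-] := gP v (set_mem vB).
      by rewrite e e1.
    rewrite asboolF => [/andP[ruv rvu]|/esym//].
    by exfalso; apply: ne; apply: wo_chain_anti rwo _ _ ruv rvu; exact: gA.
  have [||a [[+ am] _]] := rwo (mem [set (g u).2 | u in [set u | u \in S]]).
  + by move=> x; rewrite !inE => -[u /SB uB <-]; exact: gA.
  + by exists (g s).2; rewrite inE; exists s.
  rewrite inE => -[v vS va].
  pose P n := `[< exists u, [/\ u \in S, (g u).2 = a & pickle (g u).1 = n] >].
  have exP : exists n, P n by exists (pickle (g v).1); apply/asboolP; exists v.
  case: (ex_minnP exP) => n /asboolP[u [uS ua un]] nm.
  exists u; split => // w wS; rewrite /rB; case: asboolP => [e|ne].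
    by rewrite un nm//; apply/asboolP; exists w; rewrite -e.
  by rewrite ua; apply: am; rewrite inE; exists w.
- move=> u Bu; have [Au fu] := gP u Bu.
  pose S : set (I * T) := [set: I] `*` [set a | A a /\ r a (g u).2].
  have cS : countable S by apply: countableX => //; exact: rseg.
  apply: sub_countable cS.
  apply: (card_le_trans (B := [set f x.1 x.2 | x in S])); last exact: card_image_le.
  apply: subset_card_le => v [Bv]; rewrite /rB => rvu; have [Av fv] := gP v Bv.
  exists (g v) => //; split => //; split => //; move: rvu; case: asboolP => // -> _.
  exact: wo_chain_refl rwo _.
Qed.

Lemma countable_enum (T : Type) (A : set T) (x0 : T) : countable A -> A x0 ->
  exists q : nat -> T, (forall n, A (q n)) /\ forall a, A a -> exists n, q n = a.
Proof.
move=> /countable_injP[f fI] Ax0.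
have /choice[q qP] : forall n, exists b, A b /\ ((exists2 a, A a & f a = n) -> f b = n).
  move=> n; have [[a Aa fa]|H] := pselect (exists2 a, A a & f a = n); first by exists a.
  by exists x0.
exists q; split => [n|a Aa]; first by have [] := qP n.
exists (f a); have [Aq fq] := qP (f a).
by apply: fI; rewrite ?inE//; apply: fq; exists a.
Qed.

Lemma countable_subsingleton (T : Type) (A : set T) :
  (forall x y, A x -> A y -> x = y) -> countable A.
Proof.
move=> AI; have [[a Aa]|nA] := pselect (exists a, A a).
  by rewrite (_ : A = [set a])//; apply/seteqP; split => [x Ax|x ->//]; exact: AI.
by rewrite (_ : A = set0)//; apply/seteqP; split => // x Ax; apply: nA; exists x.
Qed.

Lemma countableU (T : Type) (A B : set T) :
  countable A -> countable B -> countable (A `|` B).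
Proof. by move=> cA cB; rewrite -bigcup2E; apply: bigcup_countable => // -[|[|n]] _. Qed.

Lemma countableS (T : Type) (A B : set T) : A `<=` B -> countable B -> countable A.
Proof. by move=> /subset_card_le; exact: sub_countable. Qed.

(** * Compact lines *)

(** Compactness as an induction principle: the sets with the property [P] form
    an ideal, and if [A] were not in it, the complements of its members would
    generate a proper filter on [A] without a cluster point.  Most uses of
    compactness below have this form. *)
Lemma compact_ideal (T : topologicalType) (A : set T) (P : set T -> Prop) :
  compact A -> P set0 -> (forall U V, U `<=` V -> P V -> P U) ->
  (forall U V, P U -> P V -> P (U `|` V)) ->
  (forall x, A x -> exists U, nbhs x U /\ P U) -> P A.
Proof.
move=> cA P0 PS PU Ploc; apply: contrapT => nPA.
pose F : set_system T := [set B | P (A `\` B)].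
have FF : ProperFilter F.
  split; first by rewrite /F/= setD0.
  split=> [|B C|B C BC]; rewrite /F/=.
  - by rewrite setDT.
  - by move=> PB PC; rewrite setDIr; exact: PU.
  - by apply: PS => x [Ax nC]; split => // /BC.
have [|x [Ax xF]] := cA F FF; first by rewrite /F/= setDv.
have [U [xU PUU]] := Ploc x Ax.
have [|y [nUy Uy]] := xF (~` U) U _ xU; last by [].
by rewrite /F/= setDE setCK; apply: PS PUU => y [].
Qed.

Section CompactLine.
Context (d : Order.disp_t) (K : orderTopologicalType d).
Hypothesis cK : compact [set: K].
Implicit Types (x y z : K) (A : set K).
Local Open Scope order_scope.
Local Open Scope classical_set_scope.

Lemma closed_compact_line A : closed A -> compact A.
Proof. by move=> cA; apply: subclosed_compact cA cK _. Qed.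

Lemma closed_has_max A : closed A -> A !=set0 ->
  exists m, A m /\ forall x, A x -> x <= m.
Proof.
move=> /closed_compact_line cA [a Aa]; apply: contrapT => nmax.
apply: (nmax); suff [m [Am mA]] : exists m, A m /\ forall x, (A `&` A) x -> x <= m.
  by exists m; split => // x Ax; apply: mA.
apply: (compact_ideal (P := fun U => exists m, A m /\ forall x, (U `&` A) x -> x <= m)
  cA).
- by exists a; split => // x [].
- by move=> U V UV [m [Am mV]]; exists m; split => // x [/UV ? ?]; apply: mV.
- move=> U V [m [Am mU]] [n [An nV]].
  have [mn|/ltW nm] := leP m n.
    exists n; split => // x [[Ux|Vx] Ax]; last exact: nV.
    by apply: le_trans mn; exact: mU.
  exists m; split => // x [[Ux|Vx] Ax]; first exact: mU.
  by apply: le_trans nm; exact: nV.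
- move=> x Ax; have [y Ay xy] : exists2 y, A y & x < y.
    apply: contrapT => H; apply: nmax; exists x; split => // y Ay.
    by rewrite leNgt; apply/negP => xy; apply: H; exists y.
  exists `]-oo, y[%classic; split.
    by apply: open_nbhs_nbhs; split => //=; rewrite in_itv.
  by exists y; split => // z [/=]; rewrite in_itv/= => /ltW.
Qed.

Lemma closed_has_min A : closed A -> A !=set0 ->
  exists m, A m /\ forall x, A x -> m <= x.
Proof.
move=> /closed_compact_line cA [a Aa]; apply: contrapT => nmin.
apply: (nmin); suff [m [Am mA]] : exists m, A m /\ forall x, (A `&` A) x -> m <= x.
  by exists m; split => // x Ax; apply: mA.
apply: (compact_ideal (P := fun U => exists m, A m /\ forall x, (U `&` A) x -> m <= x)
  cA).
- by exists a; split => // x [].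
- by move=> U V UV [m [Am mV]]; exists m; split => // x [/UV ? ?]; apply: mV.
- move=> U V [m [Am mU]] [n [An nV]].
  have [mn|/ltW nm] := leP m n.
    exists m; split => // x [[Ux|Vx] Ax]; first exact: mU.
    by apply: le_trans mn _; exact: nV.
  exists n; split => // x [[Ux|Vx] Ax]; last exact: nV.
  by apply: le_trans nm _; exact: mU.
- move=> x Ax; have [y Ay xy] : exists2 y, A y & y < x.
    apply: contrapT => H; apply: nmin; exists x; split => // y Ay.
    by rewrite leNgt; apply/negP => xy; apply: H; exists y.
  exists `]y, +oo[%classic; split.
    by apply: open_nbhs_nbhs; split => //=; rewrite in_itv/= andbT.
  by exists y; split => // z [/=]; rewrite in_itv/= andbT => /ltW.
Qed.

(** The supremum is the maximum of the closure. *)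
Lemma line_has_lub A (C : set K) : closed C -> A `<=` C -> A !=set0 ->
  exists m, [/\ C m, forall x, A x -> x <= m &
    forall u, (forall x, A x -> x <= u) -> m <= u].
Proof.
move=> cC AC [a Aa].
have [|m [cm mM]] := closed_has_max (@closed_closure _ A).
  by exists a; exact: subset_closure.
exists m; split.
- by move: cm; rewrite (closure_id C).1//; apply: closureS.
- by move=> x Ax; apply: mM; exact: subset_closure.
- move=> u Au; have : closure A `<=` `]-oo, u].
    rewrite [X in _ `<=` X](closure_id _).1; last exact: lray_closed.
    by apply: closureS => x Ax /=; rewrite in_itv/=; exact: Au.
  by move=> /(_ m cm)/=; rewrite in_itv.
Qed.

Lemma line_normal (R : realType) x y : x < y ->
  exists u : K -> R^o, [/\ continuous u, forall z, (0 <= u z <= 1)%R,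
    forall z, z <= x -> u z = 0%R & forall z, y <= z -> u z = 1%R].
Proof.
move=> xy; have nK : normal_space K by apply: compact_normal => //; exact: order_hausdorff.
have sep : uniform_separator `]-oo, x] `[y, +oo[.
  apply: (@normal_separatorP R K).1 => //; try exact: rray_closed; try exact: lray_closed.
  apply/seteqP; split => // z [/=]; rewrite !in_itv/= andbT => zx yz.
  by have := lt_le_trans xy (le_trans yz zx); rewrite ltxx.
exists (Urysohn `]-oo, x] `[y, +oo[); split.
- exact: Urysohn_continuous.
- by move=> z; have /(_ (Urysohn `]-oo, x] `[y, +oo[ z)) := @Urysohn_range _ R
    `]-oo, x] `[y, +oo[; rewrite /= in_itv; apply; exists z.
- move=> z zx; apply: (Urysohn_sub0 sep); exists z => //=.
- move=> z yz; apply: (Urysohn_sub1 sep); exists z => //=.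
  by rewrite in_itv/= yz.
Qed.

End CompactLine.

(** * Jumps of a separable compact line and its core *)

Lemma itv_convex (d : Order.disp_t) (T : orderType d) (i : interval T) (x y z : T) :
  x \in i -> y \in i -> (x <= z <= y)%O -> z \in i.
Proof.
case: i => l r; rewrite !itv_boundlr => /andP[lx _] /andP[_ yr] /andP[xz zy].
by rewrite (le_trans lx) ?(le_trans _ yr) ?bnd_simp.
Qed.

Section Jumps.
Context (d : Order.disp_t) (K : orderTopologicalType d).
Hypothesis cK : compact [set: K].
Variable D : set K.
Hypothesis cD : countable D.
Hypothesis dD : dense D.
Implicit Types (x y z : K) (A : set K).
Local Open Scope order_scope.
Local Open Scope classical_set_scope.

(** Relative to [A = setT] these are the jumps of the line, and relative to a
    closed set [A] they also include the gaps of [A].  A set of jumps is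
    represented by the set of their left endpoints. *)
Definition jump_in A x y := [/\ A x, A y, x < y & forall z, A z -> x < z -> y <= z].

Definition jumps A : set K := [set x | exists y, jump_in A x y].

Definition core : set K :=
  [set x | forall U, open U -> U x -> ~ countable (U `&` jumps setT)].

Lemma jump_in_inj A x y z : jump_in A x y -> jump_in A x z -> y = z.
Proof.
by move=> [_ Ay xy Hy] [_ Az xz Hz]; apply/eqP; rewrite eq_le Hy// Hz.
Qed.

Lemma dense_itv x y z : x < z -> z < y -> exists2 t, D t & x < t < y.
Proof.
move=> xz zy; have [|t [/= ]] := dD _ (itv_open x y).
  by exists z; rewrite /= in_itv/= xz.
by rewrite in_itv/= => ? ?; exists t.
Qed.

Lemma core_closed : closed core.
Proof.
rewrite -[core]setCK; apply: open_closedC; rewrite openE => x nx.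
have [U [oU Ux cU]] : exists U, [/\ open U, U x & countable (U `&` jumps setT)].
  apply: contrapT => H; apply: nx => U oU Ux cU; apply: H; by exists U.
rewrite /interior nbhsE; exists U; first by split.
by move=> y Uy /(_ U oU Uy); apply.
Qed.

Lemma countable_jumps_off_core A : closed A -> A `&` core = set0 ->
  countable (A `&` jumps setT).
Proof.
move=> cA A0; apply: (compact_ideal (P := fun U => countable (U `&` jumps setT))
  (closed_compact_line cK cA)) => [|U V UV|U V cU cV|x Ax].
- by rewrite set0I.
- by apply: countableS => x [/UV].
- by rewrite setIUl; exact: countableU.
- apply: contrapT => H; suff : (A `&` core) x by rewrite A0.
  by split => // U oU Ux cU; apply: H; exists U; split => //; exact: open_nbhs_nbhs.
Qed.

(** A neighbourhood of [x] that avoids the core and lies to the left of [y] contains a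
    point of [D], and every point of it is at most [x]. *)
Lemma off_core_left x y : jump_in setT x y -> ~ core x ->
  exists2 t, D t & t <= x /\ forall z, t <= z <= x -> ~ core z.
Proof.
move=> [_ _ xy jxy] nx.
have : nbhs x (~` core `&` `]-oo, y[).
  apply: open_nbhs_nbhs; split; last by split => //=; rewrite in_itv.
  by apply: openI => //; apply: closed_openC; exact: core_closed.
rewrite itv_nbhsE => -[i [oi xi] iU].
have [|t [ti Dt]] := dD _ (itv_open_ends_open oi); first by exists x.
have /= [_ ] := iU _ ti; rewrite in_itv/= => ty.
have tx : t <= x by rewrite leNgt; apply/negP => /jxy-/(_ I); rewrite leNgt ty.
exists t => //; split => // z tzx; have [] // := iU z.
by apply: (@itv_convex _ _ i) tzx.
Qed.

Lemma off_core_right x y : jump_in setT x y -> ~ core y ->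
  exists2 t, D t & y <= t /\ forall z, y <= z <= t -> ~ core z.
Proof.
move=> [_ _ xy jxy] ny.
have : nbhs y (~` core `&` `]x, +oo[).
  apply: open_nbhs_nbhs; split; last by split => //=; rewrite in_itv/= andbT.
  by apply: openI => //; apply: closed_openC; exact: core_closed.
rewrite itv_nbhsE => -[i [oi yi] iU].
have [|t [ti Dt]] := dD _ (itv_open_ends_open oi); first by exists y.
have /= [_ ] := iU _ ti; rewrite in_itv/= andbT => xt.
exists t => //; split; first exact: jxy.
by move=> z yzt; have [] // := iU z; apply: (@itv_convex _ _ i) yzt.
Qed.

(** If both endpoints are off the core, they lie in an interval with endpoints
    in [D] that misses the core, and compactness leaves only countably many jumps in
    each such interval.  If exactly one endpoint is in the core, the jump
    is the first or the last step between the core and a point of [D], and is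
    determined by this point. *)
Lemma countable_jumps_touching_off_core :
  countable [set x | exists y, jump_in setT x y /\ ~ (core x /\ core y)].
Proof.
pose S1 t := [set x | exists y, [/\ jump_in setT x y, core y, t <= x &
  forall z, t <= z <= x -> ~ core z]].
pose S2 t := [set x | exists y, [/\ jump_in setT x y, core x, y <= t &
  forall z, y <= z <= t -> ~ core z]].
pose S3 (p : K * K) : set K := [set x | jumps setT x /\ p.1 <= x <= p.2 /\
  forall z, p.1 <= z <= p.2 -> ~ core z].
apply: (@countableS _ _ (\bigcup_(t in D) S1 t `|` \bigcup_(t in D) S2 t `|`
  \bigcup_(p in D `*` D) S3 p)).
  move=> x [y [j nj]]; have [cx|ncx] := pselect (core x).
    have ncy : ~ core y by move=> cy; apply: nj.
    have [t Dt [yt tz]] := off_core_right j ncy.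
    by left; right; exists t => //; exists y.
  have [t Dt [tx tz]] := off_core_left j ncx.
  have [cy|ncy] := pselect (core y); first by left; left; exists t => //; exists y.
  have [s Ds [ys sz]] := off_core_right j ncy.
  right; exists (t, s) => //; split; first by exists y.
  case: j => _ _ xy jxy /=; split; first by rewrite tx (le_trans (ltW xy)).
  move=> z /andP[tz' zs]; have [zx|xz] := leP z x; first by apply: tz; rewrite tz'.
  by apply: sz; rewrite zs andbT jxy.
apply: countableU; first apply: countableU; apply: bigcup_countable => //.
- move=> t _; apply: countable_subsingleton => x x' [y [j cy tx H]] [y' [j' cy' tx' H']].
  have [xx'|xx'|//] := ltgtP x x'.
    case: j => _ _ xy /(_ x' I xx') yx'.
    by case: (H' y) => //; rewrite yx' (le_trans tx)// ltW.
  case: j' => _ _ xy /(_ x I xx') yx'.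
  by case: (H y') => //; rewrite yx' (le_trans tx')// ltW.
- move=> t _; apply: countable_subsingleton => x x' [y [j cx yt H]] [y' [j' cx' yt' H']].
  have [xx'|xx'|//] := ltgtP x x'.
    case: j => _ _ xy /(_ x' I xx') yx'; case: j' => _ _ xy' _.
    by case: (H x') => //; rewrite yx' (le_trans (ltW xy')).
  case: j' => _ _ xy' /(_ x I xx') yx'; case: j => _ _ xy _.
  by case: (H' x) => //; rewrite yx' (le_trans (ltW xy)).
- exact: countableX.
- move=> [p q] _.
  have [H|H] := pselect (forall z, p <= z <= q -> ~ core z).
    apply: (@countableS _ _ (`[p, q] `&` jumps setT)).
      by move=> x [jx [pxq _]]; split => //=; rewrite in_itv.
    apply: countable_jumps_off_core; first exact: itv_closed.
    by apply/seteqP; split => // z [/=]; rewrite in_itv/= => /H.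
  rewrite (_ : S3 _ = set0)//; apply/seteqP; split => // z [_ [_ H']].
  exact: H.
Qed.

Lemma core_uncountable x U : core x -> open U -> U x ->
  ~ countable [set z | U z /\ exists y, [/\ jump_in setT z y, core z & core y]].
Proof.
move=> cx oU Ux cU; apply: (cx U oU Ux).
apply: countableS (countableU cU countable_jumps_touching_off_core).
move=> z [Uz [y jzy]]; have [cc|] := pselect (core z /\ core y).
  by left; split => //; exists y; split => //; case: cc.
by right; exists y.
Qed.

Lemma jump_in_sub A x y : jump_in setT x y -> A x -> A y -> jump_in A x y.
Proof. by move=> [_ _ xy H] Ax Ay; split => // z _; exact: H. Qed.

(** The core is zero-dimensional: if it has points between [x] and [y], then
    uncountably many jumps of [K] there have both endpoints in the core. *)
Lemma core_jump_between x y : core x -> core y -> x < y ->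
  exists b b', [/\ jump_in core b b', x <= b & b' <= y].
Proof.
move=> cx cy xy; have [[z [cz /andP[xz zy]]]|H] :=
    pselect (exists z, core z /\ x < z < y); last first.
  exists x, y; split => //; split => // z cz xz; rewrite leNgt; apply/negP => zy.
  by apply: H; exists z; rewrite xz.
have := core_uncountable cz (itv_open x y) _; rewrite /= in_itv/= xz zy => /(_ isT).
move=> nc; have [t [/andP[xt ty] [t' [j ct ct']]]] : exists t, x < t < y /\
    exists t', [/\ jump_in setT t t', core t & core t'].
  apply: contrapT => nex; apply: nc; apply: countableS (countable0 K) => t [].
  by rewrite /= in_itv => txy ct; apply: nex; exists t.
exists t, t'; split; [exact: jump_in_sub|exact: ltW|].
by case: j => _ _ _; apply.
Qed.

(** The right jump has a point of the core as its left endpoint [j].  The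
    neighbourhood of [j] bounded by [i] and by the successor of [j] contains
    uncountably many jumps with both endpoints in the core, and [j] is the only one of
    them that is not between [i] and [j]. *)
Lemma core_jumps_uncountable i j : jumps core i -> jumps core j -> i < j ->
  ~ countable [set z | jumps core z /\ i < z < j].
Proof.
move=> [i' _] [j' [cj cj' jj' H]] ij cc.
have := core_uncountable cj (itv_open i j') _.
rewrite /= in_itv/= ij jj' => /(_ isT); apply.
apply: countableS (countableU cc (countable1 j)) => z [].
rewrite /= in_itv/= => /andP[iz zj'] [y [jzy cz cy]].
have [zj|jz|->] := ltgtP z j; last by right.
  by left; split; [exists y; exact: jump_in_sub|rewrite iz].
by have := H z cz jz; rewrite leNgt zj'.
Qed.

Lemma core_jump_below j : jumps core j -> exists2 i, jumps core i & i < j.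
Proof.
move=> [j' [cj cj' jj' H]]; apply: contrapT => nex.
have := core_uncountable cj (lray_open j') _.
rewrite /= in_itv/= jj' => /(_ isT); apply.
apply: countableS (countable1 j) => z []; rewrite /= in_itv/= => zj' [y [jzy cz cy]].
have [zj|jz|//] := ltgtP z j.
  by case: nex; exists z => //; exists y; exact: jump_in_sub.
by have := H z cz jz; rewrite leNgt zj'.
Qed.

Lemma core_jump_above j : jumps core j -> exists2 i, jumps core i & j < i.
Proof.
move=> [j' [cj cj' jj' H]]; apply: contrapT => nex.
have := core_uncountable cj' (rray_open j) _.
rewrite /= in_itv/= jj' => /(_ isT); apply.
apply: countableS (countable0 K) => z []; rewrite /= in_itv/= andbT => jz [y [jzy cz cy]].
by apply: nex; exists z => //; exists y; exact: jump_in_sub.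
Qed.

(** Intervals whose endpoints are in [D] or are endpoints of a jump form a
    basis: an endpoint that cannot be moved into [D] belongs to a jump. *)
Lemma countable_jumps_countable_basis : countable (jumps setT) ->
  exists B : set (set K), countable B /\ basis B.
Proof.
move=> cJ; pose J' := [set y | exists x, jump_in setT x y].
pose E : set (option K) := [set None] `|` Some @` (D `|` jumps setT `|` J').
have cE : countable E.
  apply: countableU => //; apply: sub_countable (card_image_le _ _) _.
  apply: countableU; first exact: countableU.
  have /choice[s sP] : forall y, exists x, J' y -> jump_in setT x y.
    by move=> y; have [[x jx]|nJ] := pselect (J' y); [exists x|exists y].
  apply/countable_injP; have /countable_injP[f fI] := cJ.
  exists (f \o s) => y y'; rewrite !inE => Jy Jy' /fI.
  rewrite !inE => e; apply: (@jump_in_inj setT (s y)); first exact: sP.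
  by rewrite e; [exact: sP|exists y; exact: sP|exists y'; exact: sP].
pose G (p : option K * option K) : set K :=
  [set x | (if p.1 is Some e then e < x else true) && (if p.2 is Some e then x < e else true)].
exists (G @` (E `*` E)); split.
  by apply: sub_countable (card_image_le _ _) _; exact: countableX.
split.
  move=> _ [[p q] _ <-].
  have -> : G (p, q) = (if p is Some e then `]e, +oo[%classic else setT) `&`
      (if q is Some e then `]-oo, e[%classic else setT).
    by apply/seteqP; split => x; rewrite /G/=; case: p => [p|]; case: q => [q|];
      rewrite /= ?in_itv/= ?andbT => //; [move=> /andP[]|case|case|case] => // -> ->.
  by apply: openI; [case: p|case: q] => *; (exact: openT || exact: rray_open || exact: lray_open).
move=> x U; rewrite itv_nbhsE => -[i [oi xi] iU].
have left_ l : l < x -> exists e, [/\ E (Some e), l <= e & e < x].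
  move=> lx; have [[z /andP[lz zx]]|H] := pselect (exists z, l < z < x).
    have [t Dt /andP[lt tx]] := dense_itv lz zx.
    by exists t; split => //; [right; exists t => //; left; left|exact: ltW].
  exists l; split => //; right; exists l => //; left; right; exists x; split => // z _ lz.
  by rewrite leNgt; apply/negP => zx; apply: H; exists z; rewrite lz.
have right_ r : x < r -> exists e, [/\ E (Some e), x < e & e <= r].
  move=> xr; have [[z /andP[xz zr]]|H] := pselect (exists z, x < z < r).
    have [t Dt /andP[lt tx]] := dense_itv xz zr.
    by exists t; split => //; [right; exists t => //; left; left|exact: ltW].
  exists r; split => //; right; exists r => //; right; exists x; split => // z _ xz.
  by rewrite leNgt; apply/negP => zr; apply: H; exists z; rewrite xz.
have [p [Ep px pi]] : exists p, [/\ E p, (if p is Some e then e < x else true) &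
    forall z, (if p is Some e then e < z else true) -> z <= x -> z \in i].
  have [[l [il lx]]|none] := pselect (exists l, i = Interval (BRight l) i.2 /\ l < x).
    have [e [Ee le ex]] := left_ l lx.
    exists (Some e); split => // z ez zx; move: xi; rewrite il !itv_boundlr.
    rewrite !bnd_simp lx (le_lt_trans le ez)/= => xr.
    by apply: le_trans xr; rewrite bnd_simp.
  exists None; split => //; first by left.
  move=> z _ zx; move: xi oi none {iU}; case: i => [[[]l|[]] r] //=; rewrite !itv_boundlr.
  - by rewrite bnd_simp => /andP[lx _] _ []; exists l.
  - by move=> /andP[_ xr] _ _; rewrite (le_trans _ xr) ?bnd_simp.
have [q [Eq qx qi]] : exists p, [/\ E p, (if p is Some e then x < e else true) &
    forall z, (if p is Some e then z < e else true) -> x <= z -> z \in i].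
  have [[l [il lx]]|none] := pselect (exists l, i = Interval i.1 (BLeft l) /\ x < l).
    have [e [Ee le ex]] := right_ l lx.
    exists (Some e); split => // z ez zx; move: xi; rewrite il !itv_boundlr.
    rewrite !bnd_simp lx (lt_le_trans ez ex) !andbT => lx'; apply: le_trans lx' _.
    by rewrite bnd_simp.
  exists None; split => //; first by left.
  move=> z _ zx; move: xi oi none {iU pi}; case: i => [l [[]r|[]]] //=; rewrite !itv_boundlr.
  - by rewrite !bnd_simp => /andP[_ lx] _ []; exists r.
  - by move=> _; case: l => [[] ?|[]].
  - by rewrite !bnd_simp andbF.
  - by move=> /andP[lx _] _ _; rewrite (le_trans lx) ?bnd_simp.
exists (G (p, q)).
  split; first by exists (p, q).
  by apply/andP; split => /=; [move: px; case: (p)|move: qx; case: (q)].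
move=> z; rewrite /G/= => /andP[pz qz]; apply: iU.
have [zx|/ltW xz] := leP z x.
  by apply: pi => //; move: pz; case: (p).
by apply: qi => //; move: qz; case: (q).
Qed.

Lemma core_nonempty : weight_omega1 K -> core !=set0.
Proof.
move=> [B [[Bb Bl] [nB _]]]; apply/set0P/eqP => c0; apply: nB.
have [|B' [cB' bB']] := countable_jumps_countable_basis.
  rewrite -[jumps setT]setTI; apply: countable_jumps_off_core => //.
  by rewrite setTI.
by apply: sub_countable cB'; exact: Bl.
Qed.

(** The left endpoint of a jump of [K] is the largest element of a basic open
    set, and the left endpoint of a gap of the core is the largest element of the
    core below some point of [D].  This bounds the number of jumps of the core by
    the weight of [K]. *)
Lemma core_jumps_image (B : set (set K)) (x0 : K) : basis B ->
  exists f : nat -> set K -> K, forall x, jumps core x -> exists n U, B U /\ f n U = x.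
Proof.
move=> [oB bB].
have [t0 Dt0] : D !=set0.
  have [|t [_ Dt]] := dD _ openT; first by exists x0.
  by exists t.
have [q [_ qD]] := countable_enum cD Dt0.
pose is_max A := [set m | A m /\ forall z, A z -> z <= m].
have is_maxP A m : is_max A m -> xget x0 (is_max A) = m.
  move=> mA; apply: xget_unique => // m' [Am' m'A]; case: mA => Am Am_.
  by apply/eqP; rewrite eq_le Am_// m'A.
exists (fun n U => if n is n'.+1 then xget x0 (is_max [set z | core z /\ z < q n'])
  else xget x0 (is_max U)).
move=> x [y [cx cy xy H]].
have Bx V : nbhs x V -> exists2 U, B U /\ U x & U `<=` V by move/bB.
have [[z /andP[xz zy]]|nz] := pselect (exists z, x < z < y).
  have [t Dt /andP[xt ty]] := dense_itv xz zy.
  have [U [BU _] _] := Bx _ filterT; have [n qn] := qD t Dt.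
  exists n.+1, U; split => //; apply: is_maxP; split; first by split => //; rewrite qn.
  move=> w [cw]; rewrite qn leNgt => wt; apply/negP => xw.
  by have := lt_trans wt ty; rewrite ltNge H.
have [|U [BU Ux] UV] := Bx `]-oo, y[.
  by apply: open_nbhs_nbhs; split => //=; rewrite in_itv.
exists 0%N, U; split => //; apply: is_maxP; split => // z /UV/=; rewrite in_itv/= => zy.
by rewrite leNgt; apply/negP => xz; apply: nz; exists z; rewrite xz.
Qed.

End Jumps.

Arguments core {d K}.

(** * Embedding a separable dense order into the reals *)

(** The order [A] is dense, has no endpoints, and [q] enumerates an
    order-dense subset.  The terms of [q] are inserted into a binary search
    tree, whose nodes are indexed by the list of turns that lead to them, latest
    turn first; the rank of a point is the real number with the corresponding
    binary expansion. *)
Section DenseEmbedding.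
Context (R : realType) (d : Order.disp_t) (T : orderType d).
Variables (A : set T) (q : nat -> T).
Local Notation lt := (@Order.lt d T).
Local Notation le := (@Order.le d T).
Hypothesis qA : forall n, A (q n).
Hypothesis q_dense : forall x y, A x -> A y -> lt x y -> exists n, lt x (q n) /\ lt (q n) y.
Hypothesis A_below : forall x, A x -> exists2 y, A y & lt y x.
Hypothesis A_above : forall x, A x -> exists2 y, A y & lt x y.

Let inner (H : set T) : set nat := [set n | H (q n) /\ exists2 z, H z & lt z (q n)].

(** Asking the pivot not to be the least element of the cell guarantees that both
    halves are nonempty and that no pivot is used twice. *)
Definition first_inner (H : set T) : nat :=
  xget 0%N [set n | inner H n /\ forall k, inner H k -> (n <= k)%N].

Fixpoint cell (s : seq bool) : set T :=
  if s is b :: s' then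
    [set z | cell s' z /\ le (q (first_inner (cell s'))) z = b]
  else A.

Let pivot s := q (first_inner (cell s)).

(** These properties of a cell are inherited by both halves. *)
Let wf (H : set T) := [/\ H !=set0, H `<=` A, forall x, H x -> exists2 y, H y & lt x y &
  forall x y z, H x -> H y -> A z -> le x z -> le z y -> H z].

Lemma wf_inner H : wf H -> inner H !=set0.
Proof.
move=> [[x Hx] HA Hup Hc]; have [y Hy xy] := Hup x Hx.
have [n [xn ny]] := q_dense (HA _ Hx) (HA _ Hy) xy.
by exists n; split; [exact: (Hc x y (q n) Hx Hy (qA n) (ltW xn) (ltW ny))|exists x].
Qed.

Lemma first_innerP H : inner H !=set0 ->
  inner H (first_inner H) /\ forall k, inner H k -> (first_inner H <= k)%N.
Proof.
move=> [n Hn]; rewrite /first_inner; case: xgetP => [m _ []//|none].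
have ex : exists k, `[< inner H k >] by exists n; apply/asboolP.
case: (ex_minnP ex) => m /asboolP Hm mmin; case: (none m); split => // k Hk.
by apply: mmin; apply/asboolP.
Qed.

Lemma wf_cell s : wf (cell s).
Proof.
elim: s => [|b s IH]; first by split => //; exists (q 0%N); exact: qA.
have [[pH [z Hz zp]] _] := first_innerP (wf_inner IH).
case: IH => -[x0 Hx0] HA Hup Hc; rewrite -/(pivot s) in zp pH *.
split.
- case: b; first by exists (pivot s); split => //; exact: lexx.
  by exists z; split => //; rewrite leNgt zp.
- by move=> x [/HA].
- move=> x [Hx]; case: b => /= xb.
    have [y Hy xy] := Hup x Hx; exists y => //; split => //.
    exact: le_trans xb (ltW xy).
  move: xb => /negbT; rewrite -ltNge => xp.
  have [n [xn np]] := q_dense (HA _ Hx) (HA _ pH) xp.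
  exists (q n) => //; split; last by apply/negbTE; rewrite -ltNge.
  by apply: (Hc x (pivot s)) => //; exact: ltW.
- move=> x y w [Hx xb] [Hy yb] Aw xw wy; split; first exact: (Hc x y w).
  case: b xb yb => /= xb yb; first exact: le_trans xb xw.
  by apply/negbTE; move: yb => /negbT; rewrite -!ltNge; exact: le_lt_trans.
Qed.

(** The indices of the pivots increase along a branch, because cells decrease and the
    pivot of a cell is the least element of the half it bounds. *)
Lemma first_inner_cell_size s : (size s <= first_inner (cell s))%N.
Proof.
elim: s => // b s /leq_ltn_trans; apply.
have [_ smin] := first_innerP (wf_inner (wf_cell s)).
have [[Hp [z Hz zp]] _] := first_innerP (wf_inner (wf_cell (b :: s))).
rewrite ltn_neqAle smin ?andbT; last first.
  by split; [exact: Hp.1|exists z => //; exact: Hz.1].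
apply/eqP => e; move: Hp Hz zp => /= [_]; rewrite -e -/(pivot s) lexx => <- [_ pz].
by rewrite ltNge pz.
Qed.

Fixpoint path (x : T) (n : nat) : seq bool :=
  if n is n'.+1 then le (pivot (path x n')) x :: path x n' else [::].

Lemma size_path x n : size (path x n) = n.
Proof. by elim: n => //= n ->. Qed.

Lemma drop_path x j n : drop j (path x (n + j)) = path x n.
Proof. by elim: j => [|j IH]; rewrite ?addn0 ?drop0// addnS. Qed.

Lemma cell_path x n : A x -> cell (path x n) x.
Proof. by move=> Ax; elim: n. Qed.

Lemma cell_eq_path s x : cell s x -> s = path x (size s).
Proof. by elim: s => //= b s IH [/IH e <-]; rewrite -e. Qed.

(** If [x] and [y] stayed together for ever, then a term of [q] between them would be
    an admissible pivot at every level, which bounds the indices of the pivots. *)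
Lemma split_level x y : A x -> A y -> lt x y ->
  exists n, [/\ path x n = path y n, lt x (pivot (path x n)) & le (pivot (path x n)) y].
Proof.
move=> Ax Ay xy; apply: contrapT => nosplit.
have same n : path x n = path y n.
  elim: n => //= n IH; rewrite -IH; congr (_ :: _).
  have [px|xp] := leP (pivot (path x n)) x; first by rewrite (le_trans px) ?ltW.
  by apply/esym/negbTE/negP => py; apply: nosplit; exists n.
have [k [xk ky]] := q_dense Ax Ay xy.
have /first_innerP[_ /(_ k)] := wf_inner (wf_cell (path x k.+1)).
have [_ _ _ Hc] := wf_cell (path x k.+1).
have Hx := cell_path k.+1 Ax; have Hy := cell_path k.+1 Ay; rewrite -same in Hy.
move=> /(_ (conj (Hc x y _ Hx Hy (qA k) (ltW xk) (ltW ky)) _)) H.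
have {}H : (first_inner (cell (path x k.+1)) <= k)%N by apply: H; exists x.
have := leq_trans (first_inner_cell_size (path x k.+1)) H.
by rewrite size_path ltnn.
Qed.

Definition width (s : seq bool) : R := 2 / 2 ^+ size s.

Fixpoint left_end (s : seq bool) : R :=
  if s is b :: s' then left_end s' + b%:R * (width s' / 2) else -1.

Lemma width_cons b s : width (b :: s) = width s / 2.
Proof. by rewrite /width /= exprS invfM; field. Qed.

Lemma width_gt0 s : 0 < width s.
Proof. by rewrite divr_gt0 ?exprn_gt0. Qed.

Definition rank0 (x : T) : R := sup (range (fun n => left_end (path x n))).

Lemma path_mono x n k : (n <= k)%N -> left_end (path x n) <= left_end (path x k) /\
  left_end (path x k) + width (path x k) <= left_end (path x n) + width (path x n).
Proof.
move=> /subnKC <-; elim: (k - n)%N => [|j [IH1 IH2]]; first by rewrite addn0.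
rewrite addnS [path x _.+1]/=; set b := le _ _; set s := path x (n + j).
rewrite width_cons /=; have := width_gt0 s; rewrite -/s in IH1 IH2.
by case: b => /=; split; lra.
Qed.

Lemma left_end_path x n k :
  left_end (path x n) <= left_end (path x k) + width (path x k).
Proof.
have := width_gt0 (path x n); have := width_gt0 (path x k).
by have [/(path_mono x)|/ltnW/(path_mono x)] := leqP n k; lra.
Qed.

Lemma rank0_itv x n :
  left_end (path x n) <= rank0 x <= left_end (path x n) + width (path x n).
Proof.
apply/andP; split.
  apply: ub_le_sup; last by exists n.
  by exists (left_end (path x 0) + width (path x 0)) => _ [k _ <-]; exact: left_end_path.
by apply: ge_sup => [|_ [k _ <-]]; [exists (left_end (path x 0)), 0%N|exact: left_end_path].
Qed.

Lemma rank0_split x n y : path x n = path y n -> lt x (pivot (path x n)) ->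
  le (pivot (path x n)) y ->
  rank0 x <= left_end (path x n) + width (path x n) / 2 <= rank0 y.
Proof.
move=> e xp py; have /andP[_] := rank0_itv x n.+1; have /andP[+ _] := rank0_itv y n.+1.
rewrite /= -e py leNgt xp /= width_cons mul0r mul1r addr0.
by rewrite -/(path x n) => -> ->.
Qed.

(** Separation at one level yields a weak inequality.  It is strict because
    the cell of [x] has points above [x], from which [x] is separated at
    a later level. *)
Lemma rank0_lt x y : A x -> A y -> lt x y -> rank0 x < rank0 y.
Proof.
move=> Ax Ay xy; have [n [e xp py]] := split_level Ax Ay xy.
have /andP[_] := rank0_split e xp py; apply: lt_le_trans.
have [_ cA cup _] := wf_cell (path x n.+1).
have [x' Hx' xx'] := cup x (cell_path _ Ax).
have [k [e' xp' px']] := split_level Ax (cA _ Hx') xx'.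
have /andP[h _] := rank0_split e' xp' px'.
have nk : (n.+1 <= k)%N.
  rewrite leqNgt; apply/negP => kn; have := cell_eq_path Hx'; rewrite size_path => ee.
  have : path x k.+1 = path x' k.+1.
    by rewrite -(drop_path x (n.+1 - k.+1)) -(drop_path x' (n.+1 - k.+1)) subnKC// ee.
  by move=> /= [+ _]; rewrite -e' px' leNgt xp'.
have [_] := path_mono x nk; have := width_gt0 (path x k).
by rewrite [path x n.+1]/= leNgt xp width_cons /=; lra.
Qed.

Lemma rank0_norm x : A x -> `|rank0 x| < 1.
Proof.
move=> Ax; have [y Ay yx] := A_below Ax; have [z Az xz] := A_above Ax.
have := rank0_lt Ay Ax yx; have := rank0_lt Ax Az xz.
have := rank0_itv y 0; have := rank0_itv z 0.
by rewrite /width /= expr0 ltr_norml; lra.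
Qed.

(** Every dyadic interval is attached to a node of the tree, so the ranks are dense. *)
Lemma dyadic_cover (u : R) n : -1 <= u < 1 ->
  exists s, [/\ size s = n, left_end s <= u & u < left_end s + width s].
Proof.
move=> u1; elim: n => [|n [s [sn su us]]].
  by exists [::]; split => //; rewrite /width /= ?expr0; lra.
exists ((left_end s + width s / 2 <= u) :: s); rewrite width_cons /= sn.
by case: (leP (left_end s + width s / 2) u) => h; split => //=; lra.
Qed.

(** The ranks lie in the open interval from -1 to 1, which [expand] maps onto
    the real line. *)
Definition rank (x : T) : R := fine (expand (rank0 x)).

Lemma rank_lt x y : A x -> A y -> lt x y -> rank x < rank y.
Proof.
move=> Ax Ay xy; have xn := rank0_norm Ax; have yn := rank0_norm Ay.
rewrite -lte_fin !fine_expand// lt_expand ?inE ?ltW//; exact: rank0_lt.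
Qed.

Lemma rank_dense (s t : R) : s < t ->
  exists x y, [/\ A x, A y, lt x y &
    forall z, A z -> le x z -> le z y -> s < rank z < t].
Proof.
move=> st; have cst : contract s%:E < contract t%:E by rewrite lt_contract lte_fin.
set a := contract s%:E in cst; set b := contract t%:E in cst.
have := contract_lt1 s; have := contract_lt1 t; rewrite -/a -/b !ltr_norml => hb ha.
pose n := (Num.truncn (4 / (b - a))).+1.
have [|sg [sn h1 h2]] := @dyadic_cover ((a + b) / 2) n; first by lra.
have wn : width sg < (b - a) / 2.
  have ba : 0 < b - a by lra.
  rewrite /width sn ltr_pdivrMr ?exprn_gt0//.
  have := truncnS_gt (4 / (b - a)); rewrite -/n ltr_pdivrMr// => h.
  have : n%:R <= 2 ^+ n :> R by rewrite -natrX ler_nat ltnW// ltn_expl.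
  by nra.
have [[x Hx] HA Hup Hc] := wf_cell sg; have [y Hy xy] := Hup x Hx.
exists x, y; split => //; [exact: HA|exact: HA|].
move=> z Az xz zy; have Hz := Hc x y z Hx Hy Az xz zy.
have /andP[] := rank0_itv z n; rewrite -sn -(cell_eq_path Hz) => r1 r2.
have int_index := rank0_norm Az; rewrite -!lte_fin fine_expand//.
have sE : expand a = s%:E by rewrite contractK.
have tE : expand b = t%:E by rewrite contractK.
rewrite -sE -tE !lt_expand ?inE ?ltW//; try exact: contract_lt1.
by apply/andP; split; lra.
Qed.

End DenseEmbedding.

(** * An omega_1-dense periodic set that avoids a Cantor set *)

Section TernarySet.
Context (R : realType).
Implicit Types (s : seq bool) (t : R).

(** The Cantor ternary set, shrunk to the middle third of the unit interval so
    that its integer translates are disjoint and contain no integer.  As for all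
    binary trees here, the head of the list is the latest turn. *)
Fixpoint cleft s : R :=
  if s is b :: s' then cleft s' + b%:R * (2 * 3^-1 ^+ (size s').+2) else 3^-1.

Definition clen s : R := 3^-1 ^+ (size s).+1.

Definition cseg s : set R := [set t | cleft s <= t <= cleft s + clen s].

Definition cset : set R := [set t | forall n, exists s, size s = n /\ cseg s t].

Lemma clen_gt0 s : 0 < clen s.
Proof. by rewrite exprn_gt0// invr_gt0. Qed.

Lemma clen_cons b s : clen (b :: s) = clen s / 3.
Proof. by rewrite /clen /= exprSr. Qed.

Lemma cleft_cons b s : cleft (b :: s) = cleft s + b%:R * (2 * (clen s / 3)).
Proof. by rewrite /clen /= -[_ / 3]exprSr. Qed.

Lemma cseg_cons b s : cseg (b :: s) `<=` cseg s.
Proof.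
move=> t; rewrite /cseg /= clen_cons -/(cleft (b :: s)) cleft_cons.
by have := clen_gt0 s; case: b => /=; lra.
Qed.

Lemma cseg_cat s' s : cseg (s' ++ s) `<=` cseg s.
Proof. by elim: s' => //= b s' IH t /cseg_cons/IH. Qed.

Lemma cseg_left s : cseg s (cleft s).
Proof. by have := clen_gt0 s; rewrite /cseg /=; lra. Qed.

Lemma cseg_bound s t : cseg s t -> 3^-1 <= t <= 2 / 3.
Proof.
rewrite -[s]cats0 => /cseg_cat; rewrite /cseg /clen /= expr1; lra.
Qed.

Lemma cseg_disjoint s s' t : size s = size s' -> cseg s t -> cseg s' t -> s = s'.
Proof.
elim: s s' => [|b s IH] [|b' s']//= [e] h h'.
have ss' := IH s' e (cseg_cons h) (cseg_cons h'); rewrite -ss' in h' *.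
congr (_ :: _); move: h h'; rewrite /cseg /= !clen_cons -!/(cleft (_ :: s)) !cleft_cons.
by have := clen_gt0 s; case: b; case: b' => //=; lra.
Qed.

(** Distinct segments of one generation are disjoint, so the segments of the next
    generation meet the segment of [s] in its outer thirds only. *)
Lemma cseg_middle s s' t : size s' = (size s).+1 ->
  cleft s + clen s / 3 < t < cleft s + 2 * (clen s / 3) -> ~ cseg s' t.
Proof.
case: s' => [//|b s'] [e] h h'; have := cseg_cons h'.
move=> /(@cseg_disjoint s' s) => /(_ e) ss'.
have {}ss' : s' = s by apply: ss'; rewrite /cseg /=; have := clen_gt0 s; lra.
move: h'; rewrite ss' /cseg /= clen_cons -/(cleft (b :: s)) cleft_cons.
by have := clen_gt0 s; case: b => /=; lra.
Qed.

Lemma cset_nowhere_dense (u v : R) : u < v ->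
  exists u' v', [/\ u <= u', u' < v', v' <= v & forall t, u' < t < v' -> ~ cset t].
Proof.
move=> uv; have [[p [Pp /andP[up pv]]]|H] := pselect (exists p, cset p /\ u < p < v);
  last first.
  by exists u, v; split => // t tuv Pt; apply: H; exists t.
pose m := Num.min (p - u) (v - p).
have m0 : 0 < m by rewrite lt_min !subr_gt0 up.
pose n := Num.truncn m^-1; have [s [sn hs]] := Pp n.
have cm : clen s < m.
  rewrite /clen sn exprVn -[m]invrK ltf_pV2 ?posrE ?invr_gt0 ?exprn_gt0//.
  have := truncnS_gt m^-1; rewrite -/n => /lt_le_trans; apply.
  by rewrite -natrX ler_nat ltnW// ltn_expl.
have := clen_gt0 s; have mu : m <= p - u by rewrite ge_min lexx.
have mv : m <= v - p by rewrite ge_min lexx orbT.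
move: hs; rewrite /cseg /= => hs c0.
exists (cleft s + clen s / 3), (cleft s + 2 * (clen s / 3)); split; try lra.
move=> t ht Pt; have [s' [s'n hs']] := Pt (size s).+1.
exact: cseg_middle s'n ht hs'.
Qed.

End TernarySet.

Section PeriodicSet.
Context (R : realType) (B0 : set R).
Hypothesis B0_dense : omega1_dense B0.

(** Adding the integers makes them available as indices that cut the line
    into translates of each other. *)
Definition periodic : set R :=
  [set t | (exists k : int, B0 (t - k%:~R) \/ t = k%:~R) /\
           forall k : int, ~ cset (t - k%:~R)].

Lemma periodicD t (k : int) : periodic t -> periodic (t + k%:~R).
Proof.
move=> [[j Bj] nP]; split.
  exists (j + k); rewrite intrD; case: Bj => [Bj|->]; [left|by right].
  by rewrite (_ : _ - _ = t - j%:~R)//; ring.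
move=> i; rewrite (_ : _ - _ = t - (i - k)%:~R); first exact: nP.
by rewrite intrB; ring.
Qed.

Lemma cset01 (t : R) : cset t -> 0 < t < 1.
Proof. by move=> /(_ 0%N)[s [_ /cseg_bound]]; lra. Qed.

Lemma periodic_int (k : int) : periodic k%:~R.
Proof.
split; first by exists k; right.
move=> j /cset01; rewrite -intrB => /andP[].
by rewrite ltr0z ltrz1; lia.
Qed.

(** Removing the translates of the Cantor set does no harm to density, since they form
    a nowhere dense closed set. *)
Lemma periodic_uncountable U : open U -> U !=set0 -> ~ countable (U `&` periodic).
Proof.
move=> oU [x Ux]; have [e e0 exU] : exists2 e : R, 0 < e & ball x e `<=` U.
  by have := oU; rewrite openE => /(_ x Ux); rewrite /interior -nbhs_ballE.
pose k := Num.floor x; have kx : k%:~R <= x by exact: floor_le.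
have xk : x < (k + 1)%:~R by exact: floorD1_gt.
have [|u [v [xu uv ve nP]]] :=
    @cset_nowhere_dense R (x - k%:~R) (Num.min (x + e - k%:~R) 1).
  by rewrite lt_min; apply/andP; split; [lra|rewrite intrD1 in xk; lra].
have [ve1 ve2] : v <= x + e - k%:~R /\ v <= 1.
  by move: ve; rewrite le_min => /andP.
have : ~ countable (`]u + k%:~R, v + k%:~R[ `&` B0).
  have [] // := B0_dense (itv_open (u + k%:~R) (v + k%:~R)) _.
  by exists ((u + v) / 2 + k%:~R); rewrite /= in_itv/=; lra.
apply: contra_not; apply: countableS => y [/=]; rewrite in_itv/= => yuv By; split.
  by apply: exU; rewrite /ball/= ltr_norml; lra.
split; first by exists 0; left; rewrite subr0.
move=> j Pj; have := cset01 Pj => j01.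
have ejk : j = k.
  have h1 : (j < k + 1) by rewrite -(ltr_int R) intrD1; lra.
  have h2 : (k < j + 1) by rewrite -(ltr_int R) intrD1; lra.
  lia.
by apply: (nP (y - k%:~R)); [lra|rewrite -ejk].
Qed.

Lemma periodic_dense : omega1_dense periodic.
Proof.
move=> U oU U0; have cB : card_omega1 (setT `&` B0).
  by apply: B0_dense; [exact: openT|exists 0].
pose f (i : int * bool) (a : R) : R := if i.2 then a + i.1%:~R else i.1%:~R.
apply: (@card_omega1_image _ _ _ f _ _ cB); first exact: periodic_uncountable.
move=> u [_ [[k [Bk|uk]] _]].
  by exists (k, true), (u - k%:~R); rewrite /f/= subrK.
have [a Ba] : (setT `&` B0) !=set0.
  apply/set0P/eqP => E; case: cB => + _; rewrite E; apply; exact: countable0.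
by exists (k, false), a; rewrite /f/=.
Qed.

End PeriodicSet.

(** * Indexing the jumps of the core *)

Section Chart.
Context (R : realType) (d : Order.disp_t) (K : orderTopologicalType d).
Hypothesis cK : compact [set: K].
Hypothesis sK : separable K.
Hypothesis wK : weight_omega1 K.

(** The ranks of the jumps of the core are omega_1-dense.  An order isomorphism
    with [periodic B0], provided by the axiom, turns the latter into a set of
    indices; [lo b] and [hi b] are the endpoints of the jump with index [b]. *)
Lemma core_chart : Baumgartner_axiom R ->
  exists (B0 : set R) (lo hi : R -> K), [/\ omega1_dense B0,
    forall b, periodic B0 b -> jump_in core (lo b) (hi b),
    forall b c, periodic B0 b -> periodic B0 c -> b < c -> (lo b < lo c)%O &
    forall x y, core x -> core y -> (x < y)%O ->
      exists b, [/\ periodic B0 b, (x <= lo b)%O & (hi b <= y)%O]].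
Proof.
move=> hBA; have [D [cD dD]] := sK.
pose L : set K := jumps core.
have [x0 cx0] := core_nonempty cK cD dD wK.
have between x y : L x -> L y -> (x < y)%O -> exists z, L z /\ (x < z < y)%O.
  move=> Lx Ly xy; apply: contrapT => nz; have := core_jumps_uncountable cK cD dD Lx Ly xy.
  apply; apply: countableS (countable0 K) => z h; apply: nz; by exists z.
have [l0 Ll0] : L !=set0.
  apply: contrapT => L0; apply: (core_uncountable cK cD dD cx0 openT I).
  apply: countableS (countable0 K) => z [_ [y [jzy cz cy]]]; apply: L0.
  by exists z, y; exact: jump_in_sub.
have /choice[p pP] : forall uv : K * K, exists z, L z /\
    ((exists w, L w /\ (uv.1 <= w <= uv.2)%O) -> (uv.1 <= z <= uv.2)%O).
  move=> uv; have [[w [Lw h]]|H] := pselect (exists w, L w /\ (uv.1 <= w <= uv.2)%O).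
    by exists w.
  by exists l0.
have [t0 Dt0] : D !=set0.
  by have [|t [_ Dt]] := dD setT _ openT; [exists x0|exists t].
have [] := @countable_enum _ (p @` (D `*` D)) (p (t0, t0)).
- by apply: sub_countable (card_image_le _ _) _; exact: countableX.
- by exists (t0, t0).
move=> q [qr qs].
have qL n : L (q n) by have [uv _ <-] := qr n; exact: (pP uv).1.
have q_dense x y : L x -> L y -> (x < y)%O -> exists n, (x < q n)%O /\ (q n < y)%O.
  move=> Lx Ly xy; have [m [Lm /andP[xm my]]] := between x y Lx Ly xy.
  have [m1 [_ /andP[xm1 m1m]]] := between x m Lx Lm xm.
  have [m2 [_ /andP[mm2 m2y]]] := between m y Lm Ly my.
  have [u Du /andP[xu um]] := dense_itv dD xm1 m1m.
  have [v Dv /andP[mv vy]] := dense_itv dD mm2 m2y.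
  have [|n qn] := qs (p (u, v)); first by exists (u, v).
  have [_ /= ] := pP (u, v); case/(_ _)/andP; first by exists m; rewrite !ltW.
  move=> up pv; exists n; rewrite qn; split; first exact: lt_le_trans up.
  exact: le_lt_trans vy.
pose r := @rank R d K L q.
have rlt x y : L x -> L y -> (x < y)%O -> r x < r y.
  apply: rank_lt => //. by move=> z Lz; exact: (core_jump_below cK cD dD Lz).
  by move=> z Lz; exact: (core_jump_above cK cD dD Lz).
have rinj x y : L x -> L y -> r x = r y -> x = y.
  move=> Lx Ly e; have [xy|xy|//] := ltgtP x y.
    by have := rlt _ _ Lx Ly xy; rewrite e ltxx.
  by have := rlt _ _ Ly Lx xy; rewrite e ltxx.
pose B0 : set R := r @` L.
have B0d : omega1_dense B0.
  move=> U oU [u Uu]; have [e e0 euU] : exists2 e : R, 0 < e & ball u e `<=` U.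
    by have := oU; rewrite openE => /(_ u Uu); rewrite /interior -nbhs_ballE.
  have nc : ~ countable (U `&` B0).
    move=> /countable_injP[g gI].
    have [|x [y [Lx Ly xy xyst]]] := @rank_dense R d K L q qL q_dense
      (core_jump_below cK cD dD) (core_jump_above cK cD dD) (u - e) (u + e); first lra.
    apply: (core_jumps_uncountable cK cD dD Lx Ly xy); apply/countable_injP.
    have UB z : [set z | jumps core z /\ (x < z < y)%O] z -> (U `&` B0) (r z).
      move=> [Lz /andP[xz zy]]; split; last by exists z.
      apply: euU; rewrite /ball/= ltr_norml.
      by have := xyst z Lz (ltW xz) (ltW zy); rewrite -/r; lra.
    exists (g \o r) => z w; rewrite !inE => hz hw gzw; apply: rinj; [exact: hz.1|exact: hw.1|].
    by apply: gI => //; rewrite inE; exact: UB.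
  have [B [[bB _] cB]] := wK.
  have [f fP] := core_jumps_image cD dD x0 bB.
  apply: (@card_omega1_image _ _ _ (fun n V => r (f n V)) _ _ cB nc).
  by move=> _ [_ [z Lz <-]]; have [n [V [BV fV]]] := fP z Lz; exists n, V; rewrite fV.
have [f [[ff fi fs] fm]] := hBA _ _ (periodic_dense B0d) B0d.
have /choice[lo loP] : forall b, exists z, periodic B0 b -> L z /\ r z = f b.
  move=> b; have [Bb|nB] := pselect (periodic B0 b); last by exists x0.
  by have [z Lz rz] := ff b Bb; exists z.
have /choice[hi hiP] : forall b, exists z, periodic B0 b -> jump_in core (lo b) z.
  move=> b; have [Bb|nB] := pselect (periodic B0 b); last by exists x0.
  by have [[z jz] _] := loP b Bb; exists z.
exists B0, lo, hi; split => //.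
- move=> b c Bb Bc bc; have [Lb rb] := loP b Bb; have [Lc rc] := loP c Bc.
  rewrite ltNge le_eqVlt; apply/negP => /orP[/eqP e|lt].
    have fbc : f b = f c by rewrite -rb -rc e.
    by move: bc; rewrite (fi b c) ?inE// ltxx.
  have := rlt _ _ Lc Lb lt; rewrite rb rc ltNge fm ?inE//.
  by rewrite ltW.
- move=> x y cx cy xy; have [b [b' [jb xb b'y]]] := core_jump_between cK cD dD cx cy xy.
  have Lb : L b by exists b'.
  have [c Bc fc] : (f @` periodic B0) (r b) by apply: fs; exists b.
  have [Lc rc] := loP c Bc; have ecb : lo c = b by apply: rinj => //; rewrite rc fc.
  have := hiP c Bc; rewrite ecb => /(jump_in_inj jb) eb'.
  by exists c; split; rewrite ?ecb// -eb'.
Qed.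

End Chart.

(** * The decomposition method *)

(** Pelczynski's decomposition method for the c_0-sum of copies of [Y], a closed
    subspace of [W].  The operators [T] and [S] make this sum complemented in [X],
    and [a] and [b] make the kernel of [T] complemented in [Y].  Sequences are
    handled through the predicate [null_seq], so that the sum itself need not be
    constructed as a normed space. *)
Section Decomposition.
Context (R : realType) (X W : normedModType R).

Definition null_seq (Y : W -> Prop) (y : nat -> W) : Prop :=
  (forall n, Y (y n)) /\
  forall e : R, 0 < e -> exists N, forall n, (N <= n)%N -> `|y n| <= e.

Variables (Y : W -> Prop) (M : R).
Hypothesis M1 : 1 <= M.
Hypothesis YB : forall (k : R) x y, Y x -> Y y -> Y (k *: x + y).
Variables (T : X -> nat -> W) (S : (nat -> W) -> X) (a : X -> W) (b : W -> X).
Local Notation null := (null_seq Y).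
Hypothesis T_null : forall f, null (T f).
Hypothesis T_lin : forall k f g n, T (k *: f + g) n = k *: T f n + T g n.
Hypothesis T_bd : forall f n, `|T f n| <= M * `|f|.
Hypothesis S_lin : forall k y z, null y -> null z ->
  S (fun n => k *: y n + z n) = k *: S y + S z.
Hypothesis S_bd : forall y C, null y -> (forall n, `|y n| <= C) -> `|S y| <= M * C.
Hypothesis TS : forall y n, null y -> T (S y) n = y n.
Hypothesis aY : forall f, Y (a f).
Hypothesis a_lin : forall k f g, a (k *: f + g) = k *: a f + a g.
Hypothesis a_bd : forall f, `|a f| <= M * `|f|.
Hypothesis b_lin : forall k f g, Y f -> Y g -> b (k *: f + g) = k *: b f + b g.
Hypothesis b_bd : forall f, Y f -> `|b f| <= M * `|f|.
Hypothesis Tb : forall w n, Y w -> T (b w) n = 0.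
Hypothesis ba : forall v, (forall n, T v n = 0) -> b (a v) = v.

Let M0 : 0 <= M. Proof. exact: le_trans M1. Qed.

Let Y0 : Y 0.
Proof.
have YT : Y (T 0 0%N) by exact: (T_null 0).1.
by have := YB (-1) YT YT; rewrite scaleN1r addNr.
Qed.

Let YD x y : Y x -> Y y -> Y (x + y).
Proof. by move=> Yx Yy; rewrite -[x]scale1r; exact: YB. Qed.

Let YN x : Y x -> Y (- x).
Proof. by move=> Yx; have := YB (-1) Yx Y0; rewrite scaleN1r addr0. Qed.

Lemma null_lin k y z : null y -> null z -> null (fun n => k *: y n + z n).
Proof.
move=> [Yy y0] [Yz z0]; split => [n|e e0]; first exact: YB.
have k0 : 0 < `|k| + 1 by rewrite ltr_pwDr.
have [N hN] := y0 (e / 2 / (`|k| + 1)) ltac:(by rewrite !divr_gt0).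
have [P hP] := z0 (e / 2) ltac:(by rewrite divr_gt0).
exists (maxn N P) => n; rewrite geq_max => /andP[Nn Pn].
rewrite (le_trans (ler_normD _ _))// normrZ [leRHS]splitr lerD ?hP//.
rewrite (@le_trans _ _ ((`|k| + 1) * (e / 2 / (`|k| + 1))))//.
  by rewrite ler_pM// ?hN// lerDl.
by rewrite mulrC divfK// gt_eqF.
Qed.

Let p w := a (b w).

Let bB x y : Y x -> Y y -> b (x - y) = b x - b y.
Proof.
move=> Yx Yy; have := b_lin (-1) Yy Yx; rewrite !scaleN1r => h.
by rewrite addrC h addrC.
Qed.

Let bD x y : Y x -> Y y -> b (x + y) = b x + b y.
Proof. by move=> Yx Yy; have := b_lin 1 Yx Yy; rewrite !scale1r. Qed.

Let bab w : Y w -> b (p w) = b w.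
Proof. by move=> Yw; apply: ba => n; exact: Tb. Qed.

Let Yp w : Y (p w). Proof. exact: aY. Qed.

(** Write [p = a b] for the projection of [Y] onto the copy of the kernel.  An element
    [f = v + S z] goes to the sequence with terms [a v + (1 - p) z_0] and
    [p z_n + (1 - p) z_(n+1)]: the copies of the kernel move one step to
    the right and the kernel takes the vacant place. *)
Let seq_of (f : X) (n : nat) : W :=
  if n is m.+1 then p (T f m) + (T f m.+1 - p (T f m.+1))
  else a (f - S (T f)) + (T f 0 - p (T f 0)).

Let tail_of (z : nat -> W) (n : nat) : W := p (z n.+1) + (z n - p (z n)).

Let of_seq (z : nat -> W) : X := b (z 0%N) + S (tail_of z).

Let p_bd w : Y w -> `|p w| <= M * M * `|w|.
Proof.
by move=> Yw; rewrite (le_trans (a_bd _))// -mulrA ler_wpM2l// b_bd.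
Qed.

Let step_bd (x y : W) C : Y x -> Y y -> `|x| <= C -> `|y| <= C ->
  `|p x + (y - p y)| <= (M * M * 2 + 1) * C.
Proof.
move=> Yx Yy xC yC; have C0 := le_trans (normr_ge0 _) xC.
have hx := p_bd Yx; have hy := p_bd Yy.
have h := ler_normD (p x) (y - p y); have h' := ler_normB y (p y).
have MM : 0 <= M * M by rewrite mulr_ge0.
by have := ler_wpM2l MM xC; have := ler_wpM2l MM yC; nra.
Qed.

Let step_Y x y : Y x -> Y y -> Y (p x + (y - p y)).
Proof. by move=> Yx Yy; apply: YD => //; apply: YD => //; exact: YN. Qed.

Let step_null (x y : nat -> W) : null x -> null y -> null (fun n => p (x n) + (y n - p (y n))).
Proof.
move=> [Yx x0] [Yy y0]; split => [n|e e0]; first exact: step_Y.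
have c0 : 0 < M * M * 2 + 1 by rewrite ltr_wpDl// mulr_ge0// mulr_ge0.
have e'0 : 0 < e / (M * M * 2 + 1) by rewrite divr_gt0.
have [N hN] := x0 _ e'0; have [P hP] := y0 _ e'0.
exists (maxn N P) => n; rewrite geq_max => /andP[Nn Pn].
rewrite (le_trans (step_bd _ _ (hN n Nn) (hP n Pn)))//.
by rewrite mulrC divfK// gt_eqF.
Qed.

Let null_shift z : null z -> null (fun n => z n.+1).
Proof.
move=> [Yz z0]; split => // e e0; have [N hN] := z0 e e0; exists N => n Nn.
by rewrite hN// (leq_trans Nn).
Qed.

Let null_unshift z : Y (z 0%N) -> null (fun n => z n.+1) -> null z.
Proof.
move=> Yz [Yz' z0]; split => [[|n]//|e e0]; have [N hN] := z0 e e0.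
by exists N.+1 => -[//|n] Nn; exact: hN.
Qed.

Let seq_of_null f : null (seq_of f).
Proof.
apply: null_unshift => /=.
  by apply: YD => //; apply: YD; [exact: (T_null f).1|exact/YN/Yp].
by apply: step_null => //; exact: null_shift.
Qed.

Let tail_of_null z : null z -> null (tail_of z).
Proof. by move=> nz; apply: step_null => //; exact: null_shift. Qed.

Let seq_ofK f : of_seq (seq_of f) = f.
Proof.
have [YT _] := T_null f; set z := T f in YT *; set v := f - S z.
have Tv n : T v n = 0.
  have := T_lin (-1) (S z) f n; rewrite !scaleN1r addrC => ->.
  by rewrite (TS _ (T_null f)) addNr.
have b0 : b (seq_of f 0%N) = v.
  rewrite /= bD//; last by apply: YD => //; exact/YN/Yp.
  by rewrite bB// bab// subrr addr0 ba.
have bS n : b (seq_of f n.+1) = b (z n).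
  rewrite /= bD//; last by apply: YD => //; exact/YN/Yp.
  by rewrite bB// !bab// subrr addr0.
have tl : tail_of (seq_of f) = z.
  apply/funext => n; rewrite /tail_of /p bS; case: n => [|n].
    by rewrite b0 /= -/z -/v [a v + _]addrC addrK addrC subrK.
  by rewrite bS /= -/z [a (b (z n)) + _]addrC addrK addrC subrK.
by rewrite /of_seq b0 tl subrK.
Qed.

Let of_seqK z n : null z -> seq_of (of_seq z) n = z n.
Proof.
move=> nz; have [Yz _] := nz; have nt := tail_of_null nz.
have Tf m : T (of_seq z) m = tail_of z m.
  by rewrite /of_seq -[b _]scale1r T_lin TS// Tb// scaler0 add0r.
have Tfe : T (of_seq z) = tail_of z by apply/funext.
have bt m : b (tail_of z m) = b (z m.+1).
  rewrite /tail_of bD//; last by apply: YD => //; exact/YN/Yp.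
  by rewrite bB// !bab// subrr addr0.
have tp m : tail_of z m - p (tail_of z m) = z m - p (z m).
  by rewrite /p bt -/(p _) /tail_of [p (z m.+1) + _]addrC addrK.
case: n => [|n]; rewrite /seq_of Tfe tp.
  by rewrite /of_seq addrK -/(p _) addrC subrK.
by rewrite /p bt -/(p _) addrC subrK.
Qed.

Let seq_of_lin k f g n : seq_of (k *: f + g) n = k *: seq_of f n + seq_of g n.
Proof.
have pl m : p (T (k *: f + g) m) = k *: p (T f m) + p (T g m).
  have Yf : Y (T f m) := (T_null f).1 m; have Yg : Y (T g m) := (T_null g).1 m.
  by rewrite /p T_lin b_lin// a_lin.
have rl m : T (k *: f + g) m - p (T (k *: f + g) m) =
    k *: (T f m - p (T f m)) + (T g m - p (T g m)).
  by rewrite pl T_lin scalerBr opprD addrACA.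
case: n => [|n]; rewrite /seq_of rl ?pl; last by rewrite [in RHS](scalerDr k (p _)) addrACA.
rewrite (_ : T (k *: f + g) = (fun n => k *: T f n + T g n)); last exact/funext.
rewrite S_lin// opprD addrACA -scalerBr a_lin.
by rewrite [in RHS](scalerDr k (a _)) addrACA.
Qed.

Let of_seq_lin k y z : null y -> null z ->
  of_seq (fun n => k *: y n + z n) = k *: of_seq y + of_seq z.
Proof.
move=> ny nz; have [Yy _] := ny; have [Yz _] := nz.
rewrite /of_seq b_lin// (_ : tail_of _ = (fun n => k *: tail_of y n + tail_of z n)).
  rewrite (S_lin k (tail_of_null ny) (tail_of_null nz)).
  by rewrite [in RHS](scalerDr k (b _)) [RHS]addrACA.
apply/funext => n; rewrite /tail_of /p !b_lin// !a_lin -!/(p _).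
by rewrite opprD !scalerDr scalerN [in RHS]addrACA; congr (_ + _); rewrite addrACA.
Qed.

Let C0 := M * (1 + M * M) + (M * M * 2 + 1) * M.

Let seq_of_bd f n : `|seq_of f n| <= C0 * `|f|.
Proof.
have MM : 0 <= M * M by rewrite mulr_ge0.
have [YT _] := T_null f.
have f0 := normr_ge0 f.
have st (x y : W) : Y x -> Y y -> `|x| <= M * `|f| -> `|y| <= M * `|f| ->
   `|p x + (y - p y)| <= (M * M * 2 + 1) * M * `|f|.
  by move=> Yx Yy hx hy; rewrite -mulrA; exact: step_bd.
have h1 : 0 <= M * (1 + M * M) * `|f| by rewrite !mulr_ge0// addr_ge0.
case: n => [|n]; rewrite /seq_of /C0 mulrDl.
  have hS : `|S (T f)| <= M * (M * `|f|) by apply: S_bd => // n; exact: T_bd.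
  have hv : `|a (f - S (T f))| <= M * (1 + M * M) * `|f|.
    rewrite (le_trans (a_bd _))// -mulrA ler_wpM2l// (le_trans (ler_normB _ _))//.
    by rewrite mulrDl mul1r lerD// -mulrA.
  rewrite (le_trans (ler_normD _ _))// lerD//.
  have Y0' : p 0 = 0.
    by have := bB Y0 Y0; rewrite /p !subrr => ->; have := a_lin (-1) 0 0;
       rewrite scaleN1r addNr scaleN1r addNr.
  by have := st 0 (T f 0%N) Y0 (YT _); rewrite Y0' add0r normr0; apply; rewrite ?mulr_ge0.
by rewrite ler_wpDl//; apply: st.
Qed.

Let of_seq_bd z C : null z -> (forall n, `|z n| <= C) -> `|of_seq z| <= (M + M * (M * M * 2 + 1)) * C.
Proof.
move=> nz zC; have [Yz _] := nz; rewrite /of_seq mulrDl.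
rewrite (le_trans (ler_normD _ _))// lerD//.
  by rewrite (le_trans (b_bd _))// ler_wpM2l.
rewrite -mulrA; apply: S_bd => [|n]; first exact: tail_of_null.
exact: step_bd.
Qed.

Let even_null z : null z -> null (fun n => z n.*2).
Proof.
move=> [Yz z0]; split => // e e0; have [N hN] := z0 e e0; exists N => n Nn.
by apply: hN; rewrite (leq_trans Nn)// -addnn leq_addr.
Qed.

Let odd_null z : null z -> null (fun n => z n.*2.+1).
Proof.
move=> [Yz z0]; split => // e e0; have [N hN] := z0 e e0; exists N => n Nn.
by apply: hN; rewrite (leq_trans Nn)// leqW// -addnn leq_addr.
Qed.

(** The even terms come from [y] and the odd terms from [z]. *)
Let mix (y z : nat -> W) (n : nat) : W := if odd n then z n./2 else y n./2.

Let mix_null y z : null y -> null z -> null (mix y z).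
Proof.
move=> [Yy y0] [Yz z0]; split => [n|e e0]; first by rewrite /mix; case: ifP.
have [N hN] := y0 e e0; have [P hP] := z0 e e0.
exists (maxn N P).*2 => n; rewrite -geq_half_double => hn; rewrite /mix.
by case: ifP => _; [apply: hP|apply: hN]; rewrite (leq_trans _ hn)// leq_max leqnn ?orbT.
Qed.

Let Phi (f : X) : (X * X)%type :=
  (of_seq (fun n => seq_of f n.*2), of_seq (fun n => seq_of f n.*2.+1)).

Let Psi (fg : (X * X)%type) : X := of_seq (mix (seq_of fg.1) (seq_of fg.2)).

Lemma banach_square : banach_isomorphic X (X * X)%type.
Proof.
have Phi_lin : linear Phi.
  move=> k f g; rewrite /Phi; congr (_, _) => /=.
    rewrite -of_seq_lin; [|exact/even_null/seq_of_null|exact/even_null/seq_of_null].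
    by congr of_seq; apply/funext => n; exact: seq_of_lin.
  rewrite -(of_seq_lin k (odd_null (seq_of_null f)) (odd_null (seq_of_null g))).
  by congr of_seq; apply/funext => n; exact: (seq_of_lin k f g n.*2.+1).
have Psi_lin : linear Psi.
  move=> k f g; rewrite /Psi -of_seq_lin; try exact: mix_null.
  by congr of_seq; apply/funext => n; rewrite /mix; case: ifP => _; exact: seq_of_lin.
have PhiK : cancel Phi Psi.
  move=> f; rewrite /Psi /Phi /= -[RHS]seq_ofK; congr of_seq; apply/funext => n.
  have nf := seq_of_null f; rewrite /mix; case: ifP => on.
    apply: etrans (of_seqK _ (odd_null nf)) (congr1 (seq_of f) _).
    by rewrite -[RHS]odd_double_half on.
  apply: etrans (of_seqK _ (even_null nf)) (congr1 (seq_of f) _).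
  by rewrite -[RHS]odd_double_half on.
have PsiK : cancel Psi Phi.
  move=> [f g]; have nm := mix_null (seq_of_null f) (seq_of_null g).
  rewrite -[in RHS](seq_ofK f) -[in RHS](seq_ofK g) /Phi.
  congr (_, _); congr of_seq; apply/funext => n.
    by apply: etrans (of_seqK _ nm) _; rewrite /mix odd_double doubleK.
  by apply: etrans (of_seqK _ nm) _; rewrite /mix /= odd_double /= uphalf_double.
pose Phi' : {linear X -> (X * X)%type} := HB.pack Phi (GRing.isLinear.Build _ _ _ _ Phi Phi_lin).
pose Psi' : {linear (X * X)%type -> X} := HB.pack Psi (GRing.isLinear.Build _ _ _ _ Psi Psi_lin).
pose C1 := M + M * (M * M * 2 + 1).
exists Phi', Psi'; split => //.
- exists (C1 * C0) => f; rewrite -mulrA /= prod_normE /= ge_max.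
  apply/andP; split.
    by apply: (of_seq_bd (even_null (seq_of_null f))) => n; exact: seq_of_bd.
  by apply: (of_seq_bd (odd_null (seq_of_null f))) => n; exact: (seq_of_bd f n.*2.+1).
- exists (C1 * C0) => -[f g]; rewrite -mulrA; apply: of_seq_bd; first exact: mix_null.
  have C00 : 0 <= C0.
    have MM : 0 <= M * M by rewrite mulr_ge0.
    by rewrite /C0 addr_ge0// !mulr_ge0// addr_ge0// mulr_ge0.
  move=> n; rewrite /mix /= prod_normE /=; case: ifP => _;
    by rewrite (le_trans (seq_of_bd _ _))// ler_wpM2l// le_max lexx ?orbT.
Qed.

End Decomposition.

(** * Averaging over a binary tree of closed sets *)

Lemma uniform_limit_continuous (R : realType) (K : topologicalType) (F : K -> R^o) :
  (forall e : R, 0 < e -> exists2 G : K -> R^o, continuous G & forall x, `|F x - G x| <= e) ->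
  continuous F.
Proof.
move=> FG x; apply/cvgrPdist_le => e e0.
have e3 : 0 < e / 3 by rewrite divr_gt0.
have [G cG hG] := FG _ e3; have /cvgrPdist_le/(_ _ e3) := cG x.
apply: filterS => y hxy.
have -> : F x - F y = (F x - G x) + (G x - G y) + (G y - F y) by rewrite !subrKA.
have h1 := ler_normD (F x - G x + (G x - G y)) (G y - F y).
have h2 := ler_normD (F x - G x) (G x - G y).
have := hG x; have := hG y; rewrite distrC; lra.
Qed.

(** The latest turn comes first, as in the trees above. *)
Fixpoint prefix_of (f : nat -> bool) (n : nat) : seq bool :=
  if n is m.+1 then f m :: prefix_of f m else [::].

Lemma size_prefix_of f n : size (prefix_of f n) = n.
Proof. by elim: n => //= n ->. Qed.

(** A node that does not satisfy the conclusion uniformly has a child that does not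
    either; following such children yields a branch that is never barred. *)
Lemma fan (P : seq bool -> Prop) : (forall s b, P s -> P (b :: s)) ->
  (forall f, exists n, P (prefix_of f n)) -> exists N, forall s, size s = N -> P s.
Proof.
move=> Pcons Pbar; pose good s := exists N, forall t, size t = N -> P (t ++ s).
have Pcat s t : P s -> P (t ++ s) by elim: t => //= b t IH /IH; exact: Pcons.
have good_up s : good (false :: s) -> good (true :: s) -> good s.
  move=> [N hN] [N' hN']; exists (maxn N N').+1 => t.
  case/lastP: t => [//|t b]; rewrite size_rcons => -[st]; rewrite cat_rcons.
  have key M : (M <= maxn N N')%N -> (forall t, size t = M -> P (t ++ b :: s)) -> P (t ++ b :: s).
    move=> Mm h; rewrite -(cat_take_drop (size t - M) t) -catA; apply: Pcat; apply: h.
    by rewrite size_drop subKn// st.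
  by case: b key => key; [apply: (key N')|apply: (key N)] => //; rewrite leq_max leqnn ?orbT.
suff [N hN] : good [::] by exists N => s /hN; rewrite cats0.
apply: contrapT => ng.
have /choice[c cP] : forall s, exists b, ~ good s -> ~ good (b :: s).
  move=> s; have [gf|] := pselect (good (false :: s)); last by exists false.
  by exists true => ngs gt; apply: ngs; exact: good_up.
pose g := fix g n := if n is m.+1 then c (g m) :: g m else [::].
have gP n : ~ good (g n) by elim: n => //= n IH; exact: cP.
have gE n : prefix_of (fun n => c (g n)) n = g n by elim: n => //= n ->.
have [n hn] := Pbar (fun n => c (g n)); rewrite gE in hn.
by apply: (gP n); exists 0%N => t /size0nil ->.
Qed.

(** At level [n] a point may turn to the closed set where [u n] is at most 2 or
    to the one where [u n] is at least 1.  The overlap leaves room for a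
    continuous partition of unity subordinate to this cover. *)
Section ClosedTree.
Context (R : realType) (K : topologicalType).
Hypothesis cK : compact [set: K].
Variables (k0 : K) (u : nat -> K -> R^o).
Hypothesis cu : forall n, continuous (u n).

Definition side n (b : bool) : set K := [set x | if b then 1 <= u n x else u n x <= 2].

(** When the node does not meet the chosen side, the child repeats the node, so that
    every branch has a point; the node is then contained in the other side. *)
Fixpoint node (s : seq bool) : set K :=
  if s is b :: s' then
    [set x | node s' x /\ (node s' `&` side (size s') b !=set0 -> side (size s') b x)]
  else setT.

Lemma side_cover n b x : ~ side n b x -> side n (~~ b) x.
Proof. by rewrite /side /=; case: b => /= /negP; rewrite -ltNge; lra. Qed.

Lemma side_closed n b : closed (side n b).
Proof.
have -> : side n b = u n @^-1` (if b then [set t | 1 <= t] else [set t | t <= 2]).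
  by apply/seteqP; split => x; case: b.
apply: closed_comp => [x _|]; first exact: cu.
by case: b; [exact: closed_ge|exact: closed_le].
Qed.

Lemma node_closed s : closed (node s).
Proof.
elim: s => [|b s IH]; first exact: closedT.
have [h|h] := pselect (node s `&` side (size s) b !=set0).
  have -> : node (b :: s) = node s `&` side (size s) b.
    by apply/seteqP; split => x [nx] => [/(_ h)|] sx; split.
  by apply: closedI => //; exact: side_closed.
by have -> : node (b :: s) = node s by apply/seteqP; split => x => [[]|nx].
Qed.

Lemma node_nonempty s : node s !=set0.
Proof.
elim: s => [|b s [x nx]]; first by exists k0.
have [[y [ny sy]]|h] := pselect (node s `&` side (size s) b !=set0); first by exists y.
by exists x.
Qed.

Lemma node_child s b x : node s x -> side (size s) b x -> node (b :: s) x.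
Proof. by move=> nx sx; split. Qed.

Lemma node_side s b : exists b', forall x, node (b :: s) x -> side (size s) b' x.
Proof.
have [h|h] := pselect (node s `&` side (size s) b !=set0).
  by exists b => x [_ /(_ h)].
by exists (~~ b) => x [nx _]; apply: side_cover => sx; apply: h; exists x.
Qed.

Lemma node_prefix_mono f n m : (n <= m)%N -> node (prefix_of f m) `<=` node (prefix_of f n).
Proof.
move=> /subnKC <-; elim: (m - n)%N => [|j IH]; first by rewrite addn0.
by rewrite addnS => x [/IH].
Qed.

Lemma branch_point_exists f : exists x, forall n, node (prefix_of f n) x.
Proof.
apply: contrapT => nx.
suff [n hn] : exists n, forall x, [set: K] x -> ~ node (prefix_of f n) x.
  by have [x /hn] := node_nonempty (prefix_of f n); apply.
apply: (compact_ideal (P := fun U => exists n, forall x, U x -> ~ node (prefix_of f n) x) cK).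
- by exists 0%N.
- by move=> U V UV [n hn]; exists n => x /UV; exact: hn.
- move=> U V [n hn] [m hm]; exists (maxn n m) => x [/hn h|/hm h] nm; apply: h;
    by apply: node_prefix_mono nm; rewrite ?leq_maxl ?leq_maxr.
- move=> x _; have [n hn] : exists n, ~ node (prefix_of f n) x.
    by apply: contrapT => h; apply: nx; exists x => n; apply: contrapT => h'; apply: h; exists n.
  exists (~` node (prefix_of f n)); split; last by exists n.
  by apply: open_nbhs_nbhs; split => //; apply: closed_openC; exact: node_closed.
Qed.

Definition branch_point f : K := projT1 (cid (branch_point_exists f)).

Lemma branch_pointP f n : node (prefix_of f n) (branch_point f).
Proof. exact: (projT2 (cid (branch_point_exists f))). Qed.

Definition unseparated x y := forall n, ~ (u n x < 1 /\ 2 < u n y).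

Lemma branch_unseparated f x y : (forall n, node (prefix_of f n) x) ->
  (forall n, node (prefix_of f n) y) -> unseparated x y.
Proof.
move=> hx hy n; have [b hb] := node_side (prefix_of f n) (f n).
have := hb x (hx n.+1); have := hb y (hy n.+1); rewrite size_prefix_of /side /=.
by case: b {hb} => h1 h2 []; lra.
Qed.

(** Along a branch the nodes shrink to a set whose points are not separated by
    [u], and on which [v] is therefore constant; compactness of [K] gives small
    oscillation at a finite level of each branch, and [fan] makes the level uniform. *)
Lemma node_small_osc (v : K -> R^o) e : continuous v ->
  (forall x y, unseparated x y -> unseparated y x -> v x = v y) -> 0 < e ->
  exists N, forall s, size s = N -> forall x y, node s x -> node s y -> `|v x - v y| <= e.
Proof.
move=> cv hv e0; apply: fan => [s b h x y [nx _] [ny _]|f]; first exact: h.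
have e2 : 0 < e / 2 by rewrite divr_gt0.
suff [n hn] : exists n, forall x, [set: K] x -> node (prefix_of f n) x ->
    `|v x - v (branch_point f)| <= e / 2.
  exists n => x y nx ny; have := hn x I nx; have := hn y I ny.
  have := ler_normB (v x - v (branch_point f)) (v y - v (branch_point f)).
  by rewrite [X in `|X| <= _ -> _](_ : _ = v x - v y) ?opprB ?subrKA//; lra.
apply: (compact_ideal (P := fun U => exists n, forall x, U x -> node (prefix_of f n) x ->
    `|v x - v (branch_point f)| <= e / 2) cK).
- by exists 0%N.
- by move=> U V UV [n hn]; exists n => x /UV; exact: hn.
- move=> U V [n hn] [m hm]; exists (maxn n m) => x [/hn h|/hm h] nm; apply: h;
    by apply: node_prefix_mono nm; rewrite ?leq_maxl ?leq_maxr.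
- move=> x _; have [hx|/existsNP[n hn]] := pselect (forall n, node (prefix_of f n) x).
    exists [set z | `|v x - v z| <= e / 2]; split.
      by have /cvgrPdist_le/(_ _ e2) := cv x.
    exists 0%N => z /=; rewrite distrC (hv x (branch_point f))//;
      by apply: (@branch_unseparated f) => // n; exact: branch_pointP.
  exists (~` node (prefix_of f n)); split; last by exists n.
  by apply: open_nbhs_nbhs; split => //; apply: closed_openC; exact: node_closed.
Qed.

Definition weight n x : R := Num.min 1 (Num.max 0 (u n x - 1)).

Lemma weight01 n x : 0 <= weight n x <= 1.
Proof. by rewrite /weight le_min ler01 le_max lexx /= ge_min lexx. Qed.

(** The partition of unity: [weight n] is the probability of turning
    to the side [true], and a side is reached with positive probability only by
    its points. *)
Lemma weight_side n x : (weight n x != 0 -> side n true x) /\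
  (weight n x != 1 -> side n false x).
Proof.
rewrite /weight /side /=; split; last first.
  by case: (leP 1 (Num.max _ _)) => [|h _]; [rewrite eqxx|move: h; rewrite gt_max; lra].
have [h|h _] := leP (u n x - 1) 0; last by lra.
by rewrite (@min_r _ _ 1 0)// ?eqxx// ltW.
Qed.

Lemma weight_continuous n : continuous (weight n : K -> R^o).
Proof.
move=> x; apply: (@continuous_min _ _ (fun=> 1 : R) (fun x => Num.max 0 (u n x - 1))).
  exact: cvg_cst.
apply: (@continuous_max _ _ (fun=> 0 : R) (fun x => u n x - 1)); first exact: cvg_cst.
by apply: cvgB; [exact: cu|exact: cvg_cst].
Qed.

(** The expected value of [g] after [n] random turns starting at node [s]. *)
Fixpoint avg (g : seq bool -> R) (n : nat) (s : seq bool) (x : K) : R :=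
  if n is m.+1 then (1 - weight (size s) x) * avg g m (false :: s) x +
    weight (size s) x * avg g m (true :: s) x
  else g s.

Lemma avg_lin (k : R) g h n s x :
  avg (fun t => k * g t + h t) n s x = k * avg g n s x + avg h n s x.
Proof. by elim: n s => //= n IH s; rewrite !IH; ring. Qed.

Lemma avg_continuous g n s : continuous (avg g n s : K -> R^o).
Proof.
elim: n s => [|n IH] s x /=; first exact: cvg_cst.
apply: cvgD; apply: cvgM; [|exact: IH|exact: weight_continuous|exact: IH].
by apply: cvgB; [exact: cvg_cst|exact: weight_continuous].
Qed.

Lemma convex_dist (w a b c e : R) : 0 <= w <= 1 ->
  (w != 1 -> `|a - c| <= e) -> (w != 0 -> `|b - c| <= e) ->
  `|(1 - w) * a + w * b - c| <= e.
Proof.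
move=> /andP[w0 w1] ha hb; have [we|wn1] := eqVneq w 1.
  by rewrite we subrr mul0r add0r mul1r hb// we oner_neq0.
have {}ha := ha wn1; have [we|wn0] := eqVneq w 0.
  by rewrite we subr0 mul0r addr0 mul1r.
have {}hb := hb wn0; move: ha hb; rewrite !ler_norml => /andP[a1 a2] /andP[b1 b2].
have v0 : 0 <= 1 - w by lra.
have := ler_wpM2l w0 b1; have := ler_wpM2l w0 b2.
by have := ler_wpM2l v0 a1; have := ler_wpM2l v0 a2; lra.
Qed.

Lemma avg_near_cst g c e m s x : (forall t, `|g (t ++ s) - c| <= e) ->
  `|avg g m s x - c| <= e.
Proof.
elim: m s => [|m IH] s h /=; first exact: (h [::]).
have h' b t : `|g (t ++ b :: s) - c| <= e by rewrite -cat_rcons.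
by apply: convex_dist (weight01 _ _) _ _ => _; apply: IH.
Qed.

Lemma avg_near_avg g e n m s x :
  (forall r, size r = (n + size s)%N -> forall t, `|g (t ++ r) - g r| <= e) ->
  `|avg g (n + m) s x - avg g n s x| <= e.
Proof.
elim: n s => [|n IH] s h; first by apply: avg_near_cst => t; exact: h.
rewrite addSn [avg g (n + m).+1 s x]/= [avg g n.+1 s x]/=; set w := weight _ _.
have h' b : `|avg g (n + m) (b :: s) x - avg g n (b :: s) x| <= e.
  by apply: IH => r /= rn; apply: h; rewrite rn addnS.
move: (h' false) (h' true); rewrite -/w.
set a := avg _ _ (false :: s) _; set a' := avg _ _ (false :: s) _.
set b := avg _ _ (true :: s) _; set b' := avg _ _ (true :: s) _ => ha hb.
rewrite (_ : _ - _ = (1 - w) * (a - a') + w * (b - b') - 0); last by ring.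
by apply: convex_dist (weight01 _ _) _ _ => _; rewrite subr0.
Qed.

(** Only nodes that contain [x] are reached with positive probability. *)
Lemma avg_near (v : K -> R) g e n s x :
  (forall t, size t = (n + size s)%N -> forall z, node t z -> `|g t - v z| <= e) ->
  node s x -> `|avg g n s x - v x| <= e.
Proof.
elim: n s => [|n IH] s h nx /=; first exact: h.
have [w0 w1] := weight_side (size s) x.
by apply: convex_dist (weight01 _ _) _ _ => [/w1|/w0] sx; apply: IH;
  [move=> t /= tn; apply: h; rewrite tn addnS|exact: node_child|
   move=> t /= tn; apply: h; rewrite tn addnS|exact: node_child].
Qed.

Definition tree_cauchy (g : seq bool -> R) := forall e : R, 0 < e ->
  exists N, forall r, (N <= size r)%N -> forall t, `|g (t ++ r) - g r| <= e.

Definition mean (g : seq bool -> R) (x : K) : R := limn (fun n => avg g n [::] x).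

Lemma mean_approx g e : tree_cauchy g -> 0 < e -> exists N, forall n, (N <= n)%N ->
  forall x, `|mean g x - avg g n [::] x| <= e.
Proof.
move=> gc e0; have close e' : 0 < e' -> exists N, forall n m, (N <= n)%N -> forall x,
    `|avg g (n + m) [::] x - avg g n [::] x| <= e'.
  move=> e'0; have [N hN] := gc e' e'0; exists N => n m Nn x.
  by apply: avg_near_avg => r; rewrite addn0 => rn; apply: hN; rewrite rn.
have cvgx x : cvgn (fun n => avg g n [::] x : R^o).
  apply: cauchy_cvg; apply/cauchy_exP => e' e'0.
  have e2 : 0 < e' / 2 by rewrite divr_gt0.
  have [N hN] := close _ e2; exists (avg g N [::] x); exists N => // n /= Nn.
  rewrite /ball/= -(subnKC Nn) distrC; apply: le_lt_trans (hN N _ _ x) _ => //.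
  by rewrite ltr_pdivrMr// ltr_pMr// ltr1n.
have [N hN] := close e e0; exists N => n Nn x.
apply/ler_addgt0Pl => t t0; have /cvgrPdist_le/(_ t t0)[M _ hM] := cvgx x.
have h1 := hM (maxn n M) (leq_maxr _ _); have h2 := hN n (maxn n M - n)%N Nn x.
rewrite subnKC ?leq_maxl// in h2.
have := ler_normD (mean g x - avg g (maxn n M) [::] x)
  (avg g (maxn n M) [::] x - avg g n [::] x).
by rewrite subrKA; move: h1 h2; rewrite /mean /=; lra.
Qed.

Lemma mean_continuous g : tree_cauchy g -> continuous (mean g : K -> R^o).
Proof.
move=> gc; apply: uniform_limit_continuous => e e0.
have [N hN] := mean_approx gc e0; exists (avg g N [::]) => [|x].
  exact: avg_continuous.
exact: hN.
Qed.

Lemma mean_lin (k : R) g h x : tree_cauchy g -> tree_cauchy h ->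
  tree_cauchy (fun t => k * g t + h t) ->
  mean (fun t => k * g t + h t) x = k * mean g x + mean h x.
Proof.
move=> gc hc ghc; apply/eqP; rewrite -subr_eq0 -normr_le0; apply/ler_addgt0Pl => e e0.
have k1 : 0 < `|k| + 2 by rewrite ltr_wpDl.
have e' : 0 < e / (`|k| + 2) by rewrite divr_gt0.
have [N1 h1] := mean_approx gc e'; have [N2 h2] := mean_approx hc e'.
have [N3 h3] := mean_approx ghc e'; pose n := maxn N1 (maxn N2 N3).
have {}h1 := h1 n (leq_maxl _ _) x.
have {}h2 : `|mean h x - avg h n [::] x| <= e / (`|k| + 2).
  by apply: h2; rewrite /n maxnCA leq_maxl.
have {}h3 : `|mean (fun t => k * g t + h t) x - avg (fun t => k * g t + h t) n [::] x|
    <= e / (`|k| + 2).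
  by apply: h3; rewrite /n maxnA leq_maxr.
rewrite avg_lin in h3; rewrite addr0.
set a := mean _ x in h3 *; set b := mean g x in h1 *; set c := mean h x in h2 *.
rewrite (_ : a - (k * b + c) = (a - (k * avg g n [::] x + avg h n [::] x)) -
   (k * (b - avg g n [::] x)) - (c - avg h n [::] x)); last by ring.
have -> : e = e / (`|k| + 2) + `|k| * (e / (`|k| + 2)) + e / (`|k| + 2).
  by field; rewrite gt_eqF.
rewrite (le_trans (ler_normB _ _))// lerD// (le_trans (ler_normB _ _))// lerD//.
by rewrite normrM ler_wpM2l.
Qed.

Lemma mean_bound g M x : tree_cauchy g -> (forall s, `|g s| <= M) -> `|mean g x| <= M.
Proof.
move=> gc gM; apply/ler_addgt0Pl => e e0; have [N hN] := mean_approx gc e0.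
have h : `|avg g N [::] x| <= M.
  by rewrite -[avg _ _ _ _]subr0; apply: avg_near_cst => t; rewrite subr0.
rewrite -[mean g x](subrK (avg g N [::] x)) (le_trans (ler_normD _ _))// lerD//.
exact: hN.
Qed.

Lemma mean_exact (v : K -> R^o) g x : continuous v ->
  (forall x y, unseparated x y -> unseparated y x -> v x = v y) ->
  tree_cauchy g -> (forall s, exists2 z, node s z & g s = v z) -> mean g x = v x.
Proof.
move=> cv hv gc gv; apply/eqP; rewrite -subr_eq0 -normr_le0; apply/ler_addgt0Pl => e e0.
have e2 : 0 < e / 2 by rewrite divr_gt0.
have [N1 h1] := mean_approx gc e2; have [N2 h2] := node_small_osc cv hv e2.
have h n : (N2 <= n)%N -> `|avg g n [::] x - v x| <= e / 2.
  move=> Nn; apply: (avg_near (v := v)) => // t; rewrite addn0 => tn z nz.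
  have [y ny ->] := gv t; pose r := drop (n - N2) t.
  have rN : size r = N2 by rewrite size_drop tn subKn.
  have sub w : node t w -> node r w.
    rewrite -{1}[t](cat_take_drop (n - N2)) -/r; elim: (take _ _) => //= b q IH [/IH].
    by [].
  by apply: (h2 r rN); exact: sub.
pose n := maxn N1 N2.
rewrite addr0 -(subrKA (avg g n [::] x)) (le_trans (ler_normD _ _))// [leRHS]splitr lerD//.
  by apply: h1; rewrite leq_maxl.
by apply: h; rewrite leq_maxr.
Qed.

End ClosedTree.

(** * Functions on a closed set with indexed jumps *)

Lemma seq_has_max (R : realType) (s : seq R) : s != [::] ->
  exists2 b, b \in s & forall c, c \in s -> c <= b.
Proof.
case: s => // x s _; elim: s x => [|y s IH] x.
  by exists x; rewrite ?mem_head// => c; rewrite inE => /eqP ->.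
have [b bs bm] := IH y; have [xb|bx] := leP x b.
  exists b; first by rewrite inE bs orbT.
  by move=> c; rewrite inE => /orP[/eqP ->//|/bm].
exists x; first exact: mem_head.
by move=> c; rewrite inE => /orP[/eqP ->//|/bm cb]; exact: le_trans cb (ltW bx).
Qed.

(** A closed subset [L] of a compact line whose jumps are indexed, in increasing order,
    by a set [B] of reals, and separate the points of [L].  A point [x] of [L] is
    then described by its cut, the set of the [b] in [B] with [lo b < x], and [L] is
    the space of all cuts. *)
Section ChartedLine.
Context (R : realType) (d : Order.disp_t) (K : orderTopologicalType d).
Hypothesis cK : compact [set: K].
Variables (L : set K) (B : set R) (lo hi : R -> K).
Hypothesis clL : closed L.
Hypothesis jL : forall b, B b -> jump_in L (lo b) (hi b).
Hypothesis lo_lt : forall b c, B b -> B c -> b < c -> (lo b < lo c)%O.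
Hypothesis zdL : forall x y, L x -> L y -> (x < y)%O ->
  exists b, [/\ B b, (x <= lo b)%O & (hi b <= y)%O].
Hypothesis B_int : forall k : int, B k%:~R.
Implicit Types (x y z w : K) (s : seq R) (F G : K -> R).

Let L_lo b : B b -> L (lo b). Proof. by case/jL. Qed.
Let L_hi b : B b -> L (hi b). Proof. by case/jL. Qed.
Let lo_hi b : B b -> (lo b < hi b)%O. Proof. by case/jL. Qed.

Lemma hi_le b x : B b -> L x -> (lo b < x)%O -> (hi b <= x)%O.
Proof. by move=> /jL[_ _ _]; exact. Qed.

Lemma lo_le b c : B b -> B c -> b <= c -> (lo b <= lo c)%O.
Proof. by move=> Bb Bc; rewrite le_eqVlt => /orP[/eqP ->//|/lo_lt h]; rewrite ltW// h. Qed.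

Lemma cut_inj x y : L x -> L y -> (forall b, B b -> (lo b < x)%O = (lo b < y)%O) -> x = y.
Proof.
have half u v : L u -> L v -> (u < v)%O -> ~ (forall b, B b -> (lo b < u)%O = (lo b < v)%O).
  move=> Lu Lv uv H; have [b [Bb ub bv]] := zdL Lu Lv uv.
  by have := H b Bb; rewrite (lt_le_trans (lo_hi Bb) bv) ltNge ub.
move=> Lx Ly H; have [xy|yx|//] := ltgtP x y; first by case: (half x y Lx Ly xy).
by case: (half y x Ly Lx yx) => b Bb; rewrite H.
Qed.

(** The point is the supremum of the right endpoints of the jumps with index in
    the cut, or the minimum of [L] if the cut is empty. *)
Lemma cut_exists (S : set R) :
  (forall b c, B b -> B c -> c < b -> S b -> S c) ->
  exists y, L y /\ forall b, B b -> (lo b < y)%O <-> S b.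
Proof.
move=> Sdown; have [m [Lm mm]] : exists m, L m /\ forall x, L x -> (m <= x)%O.
  by apply: closed_has_min => //; exists (lo 0%:~R); exact: L_lo.
have [||y [Ly yub ylub]] := line_has_lub cK
  (A := [set x | x = m \/ exists b, [/\ B b, S b & hi b = x]]) clL.
- by move=> x [->//|[b [Bb _ <-]]]; exact: L_hi.
- by exists m; left.
exists y; split => // b Bb; split => [by_|Sb].
  apply: contrapT => nS; move: by_; rewrite ltNge; apply/negP; rewrite negbK.
  apply: ylub => _ [->|[c [Bc Sc <-]]]; first by apply: mm; exact: L_lo.
  apply: hi_le => //; first exact: L_lo.
  apply: lo_lt => //; rewrite ltNge le_eqVlt; apply/negP => /orP[/eqP bc|bc].
    by apply: nS; rewrite bc.
  by apply: nS; exact: Sdown bc Sc.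
by apply: lt_le_trans (lo_hi Bb) _; apply: yub; right; exists b.
Qed.

Definition agree s x y := forall b, b \in s -> (lo b < x)%O = (lo b < y)%O.

(** For functions on the compact zero-dimensional set [L] this is continuity, in a
    form that refers to cuts only and is therefore invariant under translations of
    the indices. *)
Definition regular F := forall e : R, 0 < e -> exists s : seq R,
  (forall b, b \in s -> B b) /\ forall x y, L x -> L y -> agree s x y -> `|F x - F y| <= e.

(** The points of [L] outside [V] to the left of [x] have a maximum, and a jump
    separates it from [x]; likewise on the right. *)
Lemma agree_basis (V : set K) x : open V -> V x -> L x ->
  exists s, (forall b, b \in s -> B b) /\ forall w, L w -> agree s x w -> V w.
Proof.
move=> oV Vx Lx.
have [s1 [Bs1 h1]] : exists s, (forall b, b \in s -> B b) /\
    forall w, L w -> agree s x w -> (w <= x)%O -> V w.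
  pose A := L `&` ~` V `&` `]-oo, x].
  have cA : closed A by apply: closedI; [apply: closedI => //; exact: open_closedC|exact: lray_closed].
  have [A0|nA] := pselect (A !=set0); last first.
    exists [::]; split => // w Lw _ wx; apply: contrapT => nV; apply: nA; exists w.
    by split => //=; rewrite in_itv.
  have [m [[[Lm nVm] +] mA]] := closed_has_max cK cA A0; rewrite /= in_itv/= => mx.
  have {}mx : (m < x)%O by rewrite lt_neqAle mx andbT; apply/eqP => e; rewrite e in nVm.
  have [b [Bb mb bx]] := zdL Lm Lx mx.
  exists [:: b]; split => [c|w Lw /(_ b (mem_head _ _)) + wx].
    by rewrite inE => /eqP ->.
  rewrite (lt_le_trans (lo_hi Bb) bx) => /esym bw; apply: contrapT => nV.
  have /negP[] : ~~ (w <= m)%O by rewrite -ltNge (le_lt_trans mb bw).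
  by apply: mA; split => //=; rewrite in_itv.
have [s2 [Bs2 h2]] : exists s, (forall b, b \in s -> B b) /\
    forall w, L w -> agree s x w -> (x <= w)%O -> V w.
  pose A := L `&` ~` V `&` `[x, +oo[.
  have cA : closed A by apply: closedI; [apply: closedI => //; exact: open_closedC|exact: rray_closed].
  have [A0|nA] := pselect (A !=set0); last first.
    exists [::]; split => // w Lw _ wx; apply: contrapT => nV; apply: nA; exists w.
    by split => //=; rewrite in_itv/= wx.
  have [m [[[Lm nVm] +] mA]] := closed_has_min cK cA A0; rewrite /= in_itv/= andbT => mx.
  have {}mx : (x < m)%O by rewrite lt_neqAle mx andbT; apply/eqP => e; rewrite -e in nVm.
  have [b [Bb mb bx]] := zdL Lx Lm mx.
  exists [:: b]; split => [c|w Lw /(_ b (mem_head _ _)) + wx].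
    by rewrite inE => /eqP ->.
  rewrite ltNge mb => /esym bw; apply: contrapT => nV.
  have /negP[] : ~~ (m <= w)%O.
    by rewrite -ltNge (lt_le_trans _ bx)// (le_lt_trans _ (lo_hi Bb))// leNgt bw.
  by apply: mA; split => //=; rewrite in_itv/= wx.
exists (s1 ++ s2); split => [b|w Lw ag]; first by rewrite mem_cat => /orP[/Bs1|/Bs2].
have [wx|/ltW xw] := leP w x.
  by apply: h1 => // b bs; apply: ag; rewrite mem_cat bs.
by apply: h2 => // b bs; apply: ag; rewrite mem_cat bs orbT.
Qed.

Lemma agree_nbhs s x : (forall b, b \in s -> B b) ->
  nbhs x [set w | L w -> agree s x w].
Proof.
elim: s => [|b s IH] Bs; first by apply: filterS filterT => w _ _ b; rewrite in_nil.
have Bb : B b by apply: Bs; exact: mem_head.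
have IH' := IH (fun c cs => Bs c (mem_behead (s := b :: s) cs)).
have hb : nbhs x [set w | L w -> (lo b < x)%O = (lo b < w)%O].
  have [xb|bx] := leP x (lo b).
    have : nbhs x `]-oo, hi b[%classic.
      apply: open_nbhs_nbhs; split => //=.
      by rewrite in_itv/= (le_lt_trans xb (lo_hi Bb)).
    apply: filterS => w /=; rewrite in_itv/= => wb Lw; apply/esym/negbTE/negP => bw.
    by have := hi_le Bb Lw bw; rewrite leNgt wb.
  have : nbhs x `]lo b, +oo[%classic.
    by apply: open_nbhs_nbhs; split => //=; rewrite in_itv/= andbT.
  by apply: filterS => w /=; rewrite in_itv/= andbT => -> _.
apply: filterS2 hb IH' => w h1 h2 Lw c; rewrite inE => /orP[/eqP ->|cs]; first exact: h1.
exact: h2.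
Qed.

Lemma continuous_regular (F : K -> R^o) : continuous F -> regular F.
Proof.
move=> cF e e0.
pose P (U : set K) := exists s, (forall b, b \in s -> B b) /\
  forall x y, U x -> L x -> L y -> agree s x y -> `|F x - F y| <= e.
suff [s [Bs h]] : P [set: K] by exists s; split => // x y; exact: h.
apply: (compact_ideal cK).
- by exists [::]; split => // x y [].
- by move=> U V UV [s [Bs h]]; exists s; split => // x y /UV; exact: h.
- move=> U V [s [Bs h]] [t [Bt h']]; exists (s ++ t); split.
    by move=> b; rewrite mem_cat => /orP[/Bs|/Bt].
  move=> x y [Ux|Vx] Lx Ly ag; [apply: h|apply: h'] => // b bs;
    by apply: ag; rewrite mem_cat bs ?orbT.
- move=> x _; have e2 : 0 < e / 2 by rewrite divr_gt0.
  pose V := [set z : K | `|F x - F z| <= e / 2].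
  have nV : nbhs x V by have /cvgrPdist_le/(_ _ e2) := cF x.
  have [Lx|nLx] := pselect (L x); last first.
    exists (~` L); split; last by exists [::]; split.
    by apply: open_nbhs_nbhs; split => //; exact: closed_openC.
  have [s [Bs hs]] := agree_basis (open_interior V) nV Lx.
  exists [set w | L w -> agree s x w]; split; first exact: agree_nbhs.
  exists s; split => // w y hw Lw Ly ag.
  have /interior_subset Vw := hs w Lw (hw Lw).
  have /interior_subset Vy : V^° y.
    by apply: hs => // b bs; rewrite (hw Lw b bs) (ag b bs).
  have := ler_normB (F x - F y) (F x - F w).
  have -> : F x - F y - (F x - F w) = F w - F y by rewrite opprB addrC subrKA.
  by move: Vw Vy; rewrite /V/=; lra.
Qed.

(** The two points bound the gap of [L] that contains [x].  For [x] in [L] both are equal to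
    [x], and beyond an end of [L] both are equal to this end. *)
Lemma bracket_exists x : exists lr : K * K, [/\ L lr.1, L lr.2, (lr.1 <= lr.2)%O,
  forall z, L z -> (z <= x)%O -> (z <= lr.1)%O && (lr.1 <= x)%O &
  forall z, L z -> (x <= z)%O -> (lr.2 <= z)%O && (x <= lr.2)%O].
Proof.
pose A := L `&` `]-oo, x]; pose C := L `&` `[x, +oo[.
have cA : closed A by apply: closedI => //; exact: lray_closed.
have cC : closed C by apply: closedI => //; exact: rray_closed.
have L0 : L (lo 0%:~R) by exact: L_lo.
have Ax z : A z <-> L z /\ (z <= x)%O by rewrite /A /= in_itv.
have Cx z : C z <-> L z /\ (x <= z)%O by rewrite /C /= in_itv/= andbT.
have noA : ~ (A !=set0) -> exists2 m, C m & forall z, C z -> (m <= z)%O.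
  move=> A0; have [|m [Cm mC]] := closed_has_min cK cC; last by exists m.
  exists (lo 0%:~R); apply/Cx; split => //; rewrite leNgt; apply/negP => h.
  by apply: A0; exists (lo 0%:~R); apply/Ax; split => //; exact: ltW.
have noC : ~ (C !=set0) -> exists2 m, A m & forall z, A z -> (z <= m)%O.
  move=> C0; have [|m [Am mA]] := closed_has_max cK cA; last by exists m.
  exists (lo 0%:~R); apply/Ax; split => //; rewrite leNgt; apply/negP => h.
  by apply: C0; exists (lo 0%:~R); apply/Cx; split => //; exact: ltW.
have [A0|nA] := pselect (A !=set0); last first.
  have [m /Cx[Lm xm] mC] := noA nA; exists (m, m); split => //=.
    by move=> z Lz zx; case: nA; exists z; apply/Ax.
  by move=> z Lz xz; rewrite xm andbT; apply: mC; exact/Cx.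
have [l [/Ax[Ll lx] lA]] := closed_has_max cK cA A0.
have [C0|nC] := pselect (C !=set0); last first.
  exists (l, l); split => //=.
    by move=> z Lz zx; rewrite lx andbT; apply: lA; exact/Ax.
  by move=> z Lz xz; case: nC; exists z; apply/Cx.
have [r [/Cx[Lr xr] rC]] := closed_has_min cK cC C0.
exists (l, r); split => //=; first exact: le_trans lx xr.
  by move=> z Lz zx; rewrite lx andbT; apply: lA; exact/Ax.
by move=> z Lz xz; rewrite xr andbT; apply: rC; exact/Cx.
Qed.

Definition bracket x : K * K := projT1 (cid (bracket_exists x)).

Lemma bump_exists x y : exists u : K -> R^o, (x < y)%O ->
  [/\ continuous u, forall z, 0 <= u z <= 1,
    forall z, (z <= x)%O -> u z = 0 & forall z, (y <= z)%O -> u z = 1].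
Proof.
have [xy|yx] := ltP x y; last by exists (fun=> 0).
by have [u uP] := line_normal cK R xy; exists u.
Qed.

Definition bump x y : K -> R^o := projT1 (cid (bump_exists x y)).

Lemma bumpP x y : (x < y)%O ->
  [/\ continuous (bump x y), forall z, 0 <= bump x y z <= 1,
    forall z, (z <= x)%O -> bump x y z = 0 & forall z, (y <= z)%O -> bump x y z = 1].
Proof. exact: (projT2 (cid (bump_exists x y))). Qed.

(** The extension operator from [L] to [K]: interpolation over each gap by a fixed
    Urysohn function. *)
Definition ext F x : R := let: (l, r) := bracket x in F l + bump l r x * (F r - F l).

Lemma ext_on F x : L x -> ext F x = F x.
Proof.
move=> Lx; rewrite /ext; have [] := projT2 (cid (bracket_exists x)).
rewrite -/(bracket x); case: (bracket x) => l r /= Ll Lr lr hl hr.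
have /andP[h1 h2] := hl x Lx (lexx _); have /andP[h3 h4] := hr x Lx (lexx _).
have -> : l = x by apply/eqP; rewrite eq_le h1 h2.
have -> : r = x by apply/eqP; rewrite eq_le h3 h4.
by rewrite subrr mulr0 addr0.
Qed.

Lemma ext_lin k F G x : ext (fun z => k * F z + G z) x = k * ext F x + ext G x.
Proof. by rewrite /ext; case: (bracket x) => l r; ring. Qed.

Lemma ext_eq F G x : (forall z, L z -> F z = G z) -> ext F x = ext G x.
Proof.
move=> FG; rewrite /ext; have [] := projT2 (cid (bracket_exists x)).
by rewrite -/(bracket x); case: (bracket x) => l r /= Ll Lr _ _ _; rewrite !FG.
Qed.

Lemma ext_bound F x C : (forall z, L z -> `|F z| <= C) -> `|ext F x| <= C.
Proof.
move=> FC; rewrite /ext; have [] := projT2 (cid (bracket_exists x)).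
rewrite -/(bracket x); case: (bracket x) => l r /= Ll Lr + _ _.
rewrite le_eqVlt => /orP[/eqP ->|lr]; first by rewrite subrr mulr0 addr0 FC.
have [_ /(_ x) + _ _] := bumpP lr.
have := FC l Ll; have := FC r Lr; rewrite !ler_norml; set u := bump l r x.
move=> /andP[h1 h2] /andP[h3 h4] /andP[u0 u1].
have -> : F l + u * (F r - F l) = (1 - u) * F l + u * F r by ring.
have v0 : 0 <= 1 - u by lra.
have := ler_wpM2l u0 h1; have := ler_wpM2l u0 h2.
by have := ler_wpM2l v0 h3; have := ler_wpM2l v0 h4; lra.
Qed.

Lemma ext_cst c x : ext (fun=> c) x = c.
Proof. by rewrite /ext; case: (bracket x) => l r; rewrite subrr mulr0 addr0. Qed.

Lemma ext_step b x : B b -> ext (fun z => (lo b < z)%O%:R) x = bump (lo b) (hi b) x.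
Proof.
move=> Bb; rewrite /ext; have [] := projT2 (cid (bracket_exists x)).
rewrite -/(bracket x); case: (bracket x) => l r /= Ll Lr lr hl hr.
have [_ _ b0 b1] := bumpP (lo_hi Bb).
have [xb|bx] := leP x (lo b).
  have /andP[rb _] := hr _ (L_lo Bb) xb.
  by rewrite !ltNge rb (le_trans lr rb) b0//= subrr mulr0 addr0.
have [hx|xh] := leP (hi b) x.
  have /andP[hl' _] := hl _ (L_hi Bb) hx.
  have bl := lt_le_trans (lo_hi Bb) hl'.
  by rewrite bl (lt_le_trans bl lr) b1//= subrr mulr0 addr0.
have /andP[bl lx] := hl _ (L_lo Bb) (ltW bx).
have /andP[rh xr] := hr _ (L_hi Bb) (ltW xh).
have -> : l = lo b.
  apply/eqP; rewrite eq_le bl andbT leNgt; apply/negP => h.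
  by have := hi_le Bb Ll h; rewrite leNgt (le_lt_trans lx xh).
have -> : r = hi b.
  by apply/eqP; rewrite eq_le rh /= hi_le// (lt_le_trans bx xr).
by rewrite ltxx lo_hi//= subr0 mulr1 add0r.
Qed.

(** A step function is a combination of the indicators of the sets to the right of a
    jump, whose extensions are Urysohn functions.  The induction removes the
    last jump. *)
Lemma ext_step_continuous s F : (forall b, b \in s -> B b) ->
  (forall x y, L x -> L y -> agree s x y -> F x = F y) ->
  continuous (ext F : K -> R^o).
Proof.
have [n] := ubnP (size s); elim: n s F => // n IH s F sn Bs Fs.
have [s0|s0] := eqVneq s [::].
  have -> : ext F = (fun=> F (lo 0%:~R)).
    apply/funext => x; rewrite -[RHS](ext_cst _ x); apply: ext_eq => z Lz.
    by apply: Fs => //; [exact: L_lo|move=> b; rewrite s0 in_nil].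
  by move=> x; exact: cvg_cst.
have [b bs bmax] := seq_has_max s0; have Bb := Bs b bs.
pose c := F (hi b) - F (lo b); pose F' z := F z - c * (lo b < z)%O%:R.
pose s' := [seq b' <- s | b' != b].
have s'b b' : b' \in s' -> [/\ B b', b' \in s & b' < b].
  rewrite mem_filter /= => /andP[nb b's]; split => //; first exact: Bs.
  by rewrite lt_neqAle nb bmax.
have big x : L x -> (lo b < x)%O -> F x = F (hi b).
  move=> Lx bx; apply: Fs => //; first exact: L_hi.
  move=> b' b's; have le := lo_le (Bs _ b's) Bb (bmax _ b's).
  by rewrite (le_lt_trans le bx) (le_lt_trans le (lo_hi Bb)).
have mixed x y : L x -> L y -> agree s' x y -> (lo b < x)%O -> ~~ (lo b < y)%O ->
    F y = F (lo b).
  move=> Lx Ly ag bx nby; apply: Fs => //; first exact: L_lo.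
  move=> b' b's; have [->|nb] := eqVneq b' b; first by rewrite ltxx (negbTE nby).
  have b's' : b' \in s' by rewrite mem_filter /= nb.
  have [Bb' _ lt] := s'b b' b's'; rewrite -(ag b' b's') (lo_lt Bb' Bb lt).
  by rewrite (lt_trans (lo_lt Bb' Bb lt) bx).
have F's' x y : L x -> L y -> agree s' x y -> F' x = F' y.
  move=> Lx Ly ag; rewrite /F'.
  case bx : (lo b < x)%O; case by_ : (lo b < y)%O; rewrite ?mulr1 ?mulr0 ?subr0.
  - by rewrite !big.
  - by rewrite big// (mixed x y)// ?by_// /c; ring.
  - have ag' : agree s' y x by move=> b' b's'; rewrite ag.
    by rewrite (big y)// (mixed y x)// ?bx// /c; ring.
  - apply: Fs => // b' b's; have [->|nb] := eqVneq b' b; first by rewrite bx by_.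
    by apply: ag; rewrite mem_filter /= nb.
have -> : ext F = (fun x => c * bump (lo b) (hi b) x + ext F' x).
  apply/funext => x; rewrite -ext_step// -ext_lin; apply: ext_eq => z _.
  by rewrite /F'; ring.
have cF' : continuous (ext F' : K -> R^o).
  apply: (IH s') => //; last by move=> b' /s'b[].
  rewrite -ltnS; apply: leq_trans sn; rewrite ltnS size_filter.
  by rewrite -(count_predC (pred1 b) s) -add1n leq_add2r -has_count has_pred1.
have [cu _ _ _] := bumpP (lo_hi Bb).
by move=> x; apply: cvgD; [apply: cvgM; [exact: cvg_cst|exact: cu]|exact: cF'].
Qed.

(** Regular functions are uniform limits of step functions, and the extension
    operator does not increase the norm. *)
Lemma ext_continuous F : regular F -> continuous (ext F : K -> R^o).
Proof.
move=> rF; apply: uniform_limit_continuous => e e0.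
have [s [Bs hs]] := rF e e0.
pose r x := xget (lo 0%:~R) [set y | L y /\ agree s y x].
have rP x : L x -> L (r x) /\ agree s (r x) x.
  by move=> Lx; rewrite /r; case: xgetP => [y _ []//|/(_ x)[]]; split.
exists (ext (F \o r)).
  apply: (ext_step_continuous Bs) => x y Lx Ly ag /=; congr F; rewrite /r.
  congr xget; apply/seteqP; split => z [Lz az]; split => // b bs.
    by rewrite az// ag.
  by rewrite az// ag.
move=> x; have -> : ext F x - ext (F \o r) x = ext (fun z => -1 * F (r z) + F z) x.
  by rewrite (ext_lin (-1) (F \o r)); ring.
apply: ext_bound => z Lz; rewrite mulN1r addrC; apply: hs => //.
  exact: (rP z Lz).1.
by move=> b bs; rewrite (rP z Lz).2.
Qed.

(** * Translations of the indices and the complemented sum *)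

Hypothesis B_shift : forall b (k : int), B b -> B (b + k%:~R).

Let B_unshift b (k : int) : B b -> B (b - k%:~R).
Proof. by move=> /(B_shift (- k)); rewrite intrN. Qed.

Lemma shift_exists (k : int) x : exists y, L y /\
  forall b, B b -> (lo b < y)%O = (lo (b - k%:~R) < x)%O.
Proof.
have [b c Bb Bc cb h|y [Ly hy]] := @cut_exists [set b | (lo (b - k%:~R)%R < x)%O].
  by apply: lt_trans h; apply: lo_lt; [exact: B_unshift|exact: B_unshift|rewrite ltrD2r].
by exists y; split => // b Bb; apply/idP/idP => /(hy b Bb).
Qed.

(** The translation of the indices by [k], as an automorphism of [L]. *)
Definition shift k x : K := projT1 (cid (shift_exists k x)).

Lemma L_shift k x : L (shift k x).
Proof. exact: (projT2 (cid (shift_exists k x))).1. Qed.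

Lemma shift_cut k x b : B b -> (lo b < shift k x)%O = (lo (b - k%:~R) < x)%O.
Proof. exact: (projT2 (cid (shift_exists k x))).2. Qed.

Lemma shiftK k x : L x -> shift k (shift (- k) x) = x.
Proof.
move=> Lx; apply: cut_inj => // [|b Bb]; first exact: L_shift.
by rewrite !shift_cut ?intrN ?opprK ?subrK//; exact: B_unshift.
Qed.

Lemma shiftNK k x : L x -> shift (- k) (shift k x) = x.
Proof. by move=> /(shiftK (- k)); rewrite opprK. Qed.

Let bot_exists : exists y, L y /\ forall b, B b -> (lo b < y)%O <-> False.
Proof. exact: (@cut_exists set0). Qed.

Let top_exists : exists y, L y /\ forall b, B b -> (lo b < y)%O <-> True.
Proof. exact: (@cut_exists setT). Qed.

Definition bot : K := projT1 (cid bot_exists).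
Definition top : K := projT1 (cid top_exists).

Lemma L_bot : L bot. Proof. exact: (projT2 (cid bot_exists)).1. Qed.
Lemma L_top : L top. Proof. exact: (projT2 (cid top_exists)).1. Qed.

Lemma bot_cut b : B b -> (lo b < bot)%O = false.
Proof. by move=> Bb; apply/negP => /((projT2 (cid bot_exists)).2 b Bb). Qed.

Lemma top_cut b : B b -> (lo b < top)%O.
Proof. by move=> Bb; apply/((projT2 (cid top_exists)).2 b Bb). Qed.

Definition piece (k : int) x := (lo k%:~R < x)%O && ~~ (lo (k + 1)%:~R < x)%O.

Lemma piece_shift j k x : piece j (shift k x) = piece (j - k) x.
Proof. by rewrite /piece !shift_cut// -!intrB addrAC. Qed.

Lemma piece_inj j k x : piece j x -> piece k x -> j = k.
Proof.
have half (u v : int) : u < v -> piece u x -> ~ piece v x.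
  move=> uv /andP[_ /negP nu] /andP[vx _]; apply: nu; apply: le_lt_trans vx.
  by apply: lo_le => //; rewrite ler_int; lia.
move=> pj pk; have [jk|kj|//] := ltgtP j k; first by have := half _ _ jk pj pk.
by have := half _ _ kj pk pj.
Qed.

Lemma piece_bot k : piece k bot = false.
Proof. by rewrite /piece bot_cut. Qed.

Lemma piece_top k : piece k top = false.
Proof. by rewrite /piece !top_cut. Qed.

Lemma piece_or_top x : L x -> (lo 0%:~R < x)%O ->
  x = top \/ exists n : nat, piece n%:Z x.
Proof.
move=> Lx x0; have [ex|nex] := pselect (exists n : nat, ~~ (lo n%:~R < x)%O).
  right; case: (ex_minnP ex) => -[|n] nx nmin; first by rewrite x0 in nx.
  exists n; rewrite /piece; apply/andP; split.
    by apply/negPn/negP => /nmin; rewrite ltnn.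
  by rewrite addrC -intS.
left; apply: cut_inj => // [|b Bb]; first exact: L_top.
rewrite top_cut//; pose n := (Num.truncn b).+1.
have : (lo n%:~R < x)%O by apply/negPn/negP => h; apply: nex; exists n.
by apply: le_lt_trans; apply: lo_le => //; rewrite -pmulrn; exact/ltW/truncnS_gt.
Qed.

Lemma piece_or_bot x : L x -> ~~ (lo 0%:~R < x)%O ->
  x = bot \/ exists n : nat, piece (Negz n) x.
Proof.
move=> Lx x0; have [ex|nex] := pselect (exists n : nat, (lo (- n%:~R)%R < x)%O).
  right; case: (ex_minnP ex) => -[|n] nx nmin; first by rewrite -intrN oppr0 (negbTE x0) in nx.
  exists n; rewrite /piece NegzE; apply/andP; split; first by rewrite intrN.
  rewrite intS opprD addrAC addNr add0r intrN.
  by apply/negP => /nmin; rewrite ltnn.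
left; apply: cut_inj => // [|b Bb]; first exact: L_bot.
rewrite bot_cut//; apply/negP => bx; apply: nex; exists (Num.truncn (- b)).+1.
apply: le_lt_trans bx; apply: lo_le => //.
  by rewrite -intrN.
by rewrite lerNl -pmulrn; exact/ltW/truncnS_gt.
Qed.

(** A bijection with the natural numbers, since the pieces are indexed by the integers and
    the terms of sequences by the natural numbers. *)
Definition nth_int (n : nat) : int := if odd n then Negz n./2 else Posz n./2.
Definition int_index (k : int) : nat :=
  match k with Posz m => m.*2 | Negz m => m.*2.+1 end.

Lemma int_indexK k : nth_int (int_index k) = k.
Proof. by case: k => m; rewrite /nth_int /int_index /= odd_double /= ?doubleK ?uphalf_double. Qed.

Lemma nth_intK n : int_index (nth_int n) = n.
Proof. by rewrite -[RHS]odd_double_half /nth_int; case: odd. Qed.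

(** The end of [L] towards which the pieces with index [k] tend. *)
Definition endpoint (k : int) : K := if (0 <= k) then top else bot.

Lemma L_endpoint k : L (endpoint k).
Proof. by rewrite /endpoint; case: ifP => _; [exact: L_top|exact: L_bot]. Qed.

(** Subtracting the value at the end makes these functions tend to 0. *)
Definition coord F (n : nat) : K -> R :=
  fun w => if piece 0 w then F (shift (nth_int n) w) - F (endpoint (nth_int n)) else 0.

Lemma piece_agree k x y s : k%:~R \in s -> (k + 1)%:~R \in s -> agree s x y ->
  piece k x = piece k y.
Proof. by move=> k0 k1 ag; rewrite /piece !ag. Qed.

Lemma agree_shift k s x y : (forall b, b \in s -> B b) ->
  agree [seq b + k%:~R | b <- s] x y -> agree s (shift (- k) x) (shift (- k) y).
Proof.
move=> Bs ag b bs; have Bb := Bs b bs; rewrite !shift_cut// intrN opprK; apply: ag.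
by apply/mapP; exists b.
Qed.

Lemma coord_regular F n : regular F -> regular (coord F n).
Proof.
move=> rF e e0; have [s [Bs hs]] := rF e e0; set k := nth_int n.
exists (0%:~R :: (0 + 1)%:~R :: [seq b + (- k)%:~R | b <- s]); split.
  move=> b; rewrite !inE => /or3P[/eqP ->|/eqP ->|/mapP[c cs ->]] //.
  exact/B_shift/Bs.
move=> x y Lx Ly ag; rewrite /coord (@piece_agree 0 x y _ _ _ ag) ?inE ?eqxx ?orbT//.
case: ifP => _; last by rewrite subrr normr0 ltW.
rewrite opprB addrA subrK; apply: hs; try exact: L_shift.
rewrite -/k -[k]opprK; apply: agree_shift => // b bs; apply: ag.
by rewrite !inE bs !orbT.
Qed.

(** When [n] is large, the piece with index [nth_int n] is beyond all the jumps at which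
    [F] varies by more than [e]. *)
Lemma coord_small F e : regular F -> 0 < e -> exists N, forall n, (N <= n)%N ->
  forall w, `|coord F n w| <= e.
Proof.
move=> rF e0; have [s [Bs hs]] := rF e e0.
have [m hm] : exists m : nat, forall b, b \in s -> `|b| <= m%:R.
  elim: s {Bs hs} => [|b s [m IH]]; first by exists 0%N.
  exists (maxn m (Num.truncn `|b|).+1) => c; rewrite inE => /orP[/eqP ->|/IH h].
    by apply: le_trans (ltW (truncnS_gt _)) _; rewrite ler_nat leq_max leqnn orbT.
  by apply: le_trans h _; rewrite ler_nat leq_max leqnn.
exists m.+1.*2 => n Nn w; rewrite /coord; case: ifP => [/andP[w0 w1]|_]; last first.
  by rewrite normr0 ltW.
have hn : (m.+1 <= n./2)%N by rewrite geq_half_double.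
apply: hs; [exact: L_shift|exact: L_endpoint|].
move=> b bs; have Bb := Bs b bs; rewrite shift_cut//.
have := hm b bs; rewrite ler_norml => /andP[mb bm].
have hnR : m%:R + 1 <= (n./2)%:R :> R by rewrite natr1 ler_nat.
rewrite /endpoint /nth_int; case: odd => /=.
  rewrite bot_cut//; apply/negbTE; apply: contraNN w1; apply: le_lt_trans.
  apply: lo_le => //; first exact: B_unshift.
  by rewrite NegzE intrN opprK -pmulrn -natr1 add0r -[1%:~R]/(1%:R); lra.
rewrite top_cut//; apply: le_lt_trans w0; apply: lo_le => //; first exact: B_unshift.
by rewrite -pmulrn; lra.
Qed.

Definition glue (y : nat -> K -> R) x : R :=
  let n := xget 0%N [set n | piece (nth_int n) x] in
  if piece (nth_int n) x then y n (shift (- nth_int n) x) else 0.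

Lemma glueE (y : nat -> K -> R) n x : piece (nth_int n) x -> glue y x = y n (shift (- nth_int n) x).
Proof.
move=> px; rewrite /glue; have -> : xget 0%N [set n | piece (nth_int n) x] = n.
  apply: xget_unique => // m pm; apply: (can_inj nth_intK); exact: piece_inj pm px.
by rewrite px.
Qed.

Lemma glue0 (y : nat -> K -> R) x : (forall n, ~~ piece (nth_int n) x) -> glue y x = 0.
Proof. by move=> h; rewrite /glue (negbTE (h _)). Qed.

Lemma glueP (P : R -> Prop) (y : nat -> K -> R) x : P 0 ->
  (forall n, piece (nth_int n) x -> P (y n (shift (- nth_int n) x))) -> P (glue y x).
Proof.
move=> P0 Py; have [[n px]|h] := pselect (exists n, piece (nth_int n) x).
  by rewrite (glueE _ px); exact: Py.
by rewrite glue0// => n; apply/negP => px; apply: h; exists n.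
Qed.

(** Beyond finitely many pieces the values are small, and on each of the remaining pieces
    finitely many jumps suffice. *)
Lemma glue_regular (y : nat -> K -> R) : (forall n, regular (y n)) ->
  (forall e : R, 0 < e -> exists N, forall n, (N <= n)%N -> forall w, L w -> `|y n w| <= e) ->
  regular (glue y).
Proof.
move=> ry y0 e e0; have e2 : 0 < e / 2 by rewrite divr_gt0.
have [N hN] := y0 _ e2.
have [s [Bs hs]] : exists s, (forall b, b \in s -> B b) /\
    forall n, (n < N)%N -> forall u v, L u -> L v -> agree s u v ->
    piece (nth_int n) u = piece (nth_int n) v /\
    `|y n (shift (- nth_int n) u) - y n (shift (- nth_int n) v)| <= e.
  elim: N {hN} => [|N [s [Bs hs]]]; first by exists [::].
  have [t [Bt ht]] := ry N e e0.
  exists (s ++ (nth_int N)%:~R :: (nth_int N + 1)%:~R :: [seq b + (nth_int N)%:~R | b <- t]); split.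
    move=> b; rewrite mem_cat !inE => /or4P[/Bs|/eqP ->|/eqP ->|/mapP[c ct ->]] //.
    exact/B_shift/Bt.
  move=> n; rewrite ltnS leq_eqVlt => /orP[/eqP ->|nN] u v Lu Lv ag; last first.
    by apply: hs => // b bs; apply: ag; rewrite mem_cat bs.
  split; first by apply: (piece_agree _ _ ag); rewrite mem_cat !inE eqxx ?orbT.
  apply: ht; try exact: L_shift.
  by apply: agree_shift => // b bs; apply: ag; rewrite mem_cat !inE bs !orbT.
exists s; split => // u v Lu Lv ag.
have [[n [nN pu]]|nu] := pselect (exists n, (n < N)%N /\ piece (nth_int n) u).
  have [pv h] := hs n nN u v Lu Lv ag; rewrite pu in pv.
  by rewrite (glueE _ pu) (glueE _ (esym pv)).
have small w : L w -> ~ (exists n, (n < N)%N /\ piece (nth_int n) w) -> `|glue y w| <= e / 2.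
  move=> Lw nw; apply: (glueP (P := fun r => `|r| <= e / 2)) => [|n pw]; first by rewrite normr0 ltW.
  apply: hN; last exact: L_shift.
  by rewrite leqNgt; apply/negP => nN; apply: nw; exists n.
have nv : ~ (exists n, (n < N)%N /\ piece (nth_int n) v).
  move=> [n [nN pv]]; apply: nu; exists n; split => //.
  by have [-> _] := hs n nN u v Lu Lv ag.
rewrite (le_trans (ler_normB _ _))// [leRHS]splitr lerD//; exact: small.
Qed.

Local Notation C := (Cspace R cK).

(** The value 0 for discontinuous functions is a convention that keeps the operators total. *)
Definition to_C (F : K -> R^o) : C :=
  if pselect (continuous F) is left h then Cfun (introT (contfunP F) h) else 0.

Lemma to_CE (F : K -> R^o) x : continuous F -> to_C F x = F x.
Proof. by move=> cF; rewrite /to_C; case: pselect. Qed.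

Lemma C_regular (f : C) : regular f.
Proof. exact/continuous_regular/cfun_continuous. Qed.

Lemma C_eq (f g : C) : (forall x, f x = g x) -> f = g.
Proof. by move=> fg; apply: val_inj; apply/funext. Qed.

Lemma norm_C_le (f : C) M : 0 <= M -> (forall x, `|f x| <= M) -> `|f| <= M.
Proof. exact: supnorm_le. Qed.

Lemma norm_C_ub (f : C) x : `|f x| <= `|f|.
Proof. exact: supnorm_ub. Qed.

Definition on_piece0 (f : K -> R) x : R := if piece 0 x then f x else 0.

(** The continuous functions on piece 0, represented by their extensions to [K]. *)
Definition piece0_space (f : C) : Prop := forall x, f x = ext (on_piece0 f) x.

Definition analysis (f : C) (n : nat) : C := to_C (ext (coord f n)).

Definition synthesis (y : nat -> C) : C := to_C (ext (glue y)).

Lemma analysisE f n x : analysis f n x = ext (coord f n) x.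
Proof. by apply: to_CE; apply/ext_continuous/coord_regular/C_regular. Qed.

Lemma piece0_spaceP F : regular F -> (forall x, L x -> ~~ piece 0 x -> F x = 0) ->
  piece0_space (to_C (ext F)).
Proof.
move=> rF F0 x; rewrite to_CE; last exact: ext_continuous.
apply: ext_eq => z Lz; rewrite /on_piece0; case: ifP => [_|/negbT h].
  by rewrite to_CE ?ext_on//; exact: ext_continuous.
exact: F0.
Qed.

Lemma piece0_space_lin (k : R) (f g : C) : piece0_space f -> piece0_space g ->
  piece0_space (k *: f + g).
Proof.
move=> hf hg x; rewrite -[LHS]/(k * f x + g x) hf hg -ext_lin; apply: ext_eq => z Lz.
by rewrite /on_piece0; case: ifP => // _; rewrite mulr0 addr0.
Qed.

Local Notation null := (null_seq piece0_space).

Lemma analysis_null f : null (analysis f).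
Proof.
split => [n|e e0].
  apply: piece0_spaceP => [|x Lx]; first exact/coord_regular/C_regular.
  by rewrite /coord => /negbTE ->.
have [N hN] := coord_small (C_regular f) e0; exists N => n Nn.
apply: norm_C_le => [|x]; first exact: ltW.
by rewrite analysisE; apply: ext_bound => z _; exact: hN.
Qed.

Lemma analysis_lin (k : R) f g n :
  analysis (k *: f + g) n = k *: analysis f n + analysis g n.
Proof.
apply: C_eq => x; rewrite -[RHS]/(k * analysis f n x + analysis g n x) !analysisE -ext_lin.
apply: ext_eq => z _; rewrite /coord; case: ifP => _; last by rewrite mulr0 addr0.
have E w : (k *: f + g : C) w = k * f w + g w by [].
by rewrite !E; ring.
Qed.

Lemma analysis_bound f n : `|analysis f n| <= 2 * `|f|.
Proof.
apply: norm_C_le => [|x]; first by rewrite mulr_ge0.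
rewrite analysisE; apply: ext_bound => z _; rewrite /coord.
case: ifP => _; last by rewrite normr0 mulr_ge0.
by rewrite (le_trans (ler_normB _ _))// mulr2n mulrDl mul1r lerD// norm_C_ub.
Qed.

Lemma synthesisE (y : nat -> C) x : null y -> synthesis y x = ext (glue y) x.
Proof.
move=> [_ y0]; apply: to_CE; apply: ext_continuous; apply: glue_regular => [n|e e0].
  exact: C_regular.
have [N hN] := y0 e e0; exists N => n Nn w _.
exact: le_trans (norm_C_ub _ _) (hN n Nn).
Qed.

Lemma synthesis_lin (k : R) (y z : nat -> C) : null y -> null z ->
  synthesis (fun n => k *: y n + z n) = k *: synthesis y + synthesis z.
Proof.
move=> ny nz; apply: C_eq => x.
rewrite -[RHS]/(k * synthesis y x + synthesis z x) !synthesisE//; last first.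
  exact: null_lin piece0_space_lin _ _ _ ny nz.
rewrite -ext_lin; apply: ext_eq => w Lw.
have [[n pw]|h] := pselect (exists n, piece (nth_int n) w).
  by rewrite !(glueE _ pw).
have h' n : ~~ piece (nth_int n) w by apply/negP => pw; apply: h; exists n.
by rewrite !glue0// mulr0 addr0.
Qed.

Lemma synthesis_bound (y : nat -> C) M : null y -> (forall n, `|y n| <= M) -> `|synthesis y| <= M.
Proof.
move=> ny yM; have M0 : 0 <= M := le_trans (normr_ge0 _) (yM 0%N).
apply: norm_C_le => // x; rewrite synthesisE//; apply: ext_bound => z _.
apply: (glueP (P := fun r => `|r| <= M)) => [|n _]; first by rewrite normr0.
exact: le_trans (norm_C_ub _ _) (yM n).
Qed.

Lemma synthesisK (y : nat -> C) n : null y -> analysis (synthesis y) n = y n.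
Proof.
move=> ny; apply: C_eq => x; rewrite analysisE ny.1; apply: ext_eq => z Lz.
rewrite /coord /on_piece0; case: ifP => // pz; rewrite !synthesisE//.
rewrite !ext_on//; [|exact: L_endpoint|exact: L_shift].
have ps : piece (nth_int n) (shift (nth_int n) z) by rewrite piece_shift subrr.
rewrite (glueE _ ps) shiftNK// glue0 ?subr0// => m.
by rewrite /endpoint; case: ifP => _; rewrite ?piece_top ?piece_bot.
Qed.

(** A coordinate vanishes if and only if the function is constant on the piece, with
    the value that it has at the end of [L]. *)
Lemma analysis_ker (f : C) x : (forall n, analysis f n = 0) -> L x ->
  f x = f (if (lo 0%:~R < x)%O then top else bot).
Proof.
move=> f0 Lx; have key k : piece k x -> f x = f (endpoint k).
  move=> px; have := f0 (int_index k) => /(congr1 (fun g : C => g (shift (- k) x))).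
  rewrite analysisE ext_on; last exact: L_shift.
  have p0 : piece 0 (shift (- k) x) by rewrite piece_shift sub0r opprK.
  by rewrite /coord p0 int_indexK shiftK// => /subr0_eq.
case: ifPn => x0.
  have [->//|[n /key ->]] := piece_or_top Lx x0.
  by rewrite /endpoint.
have [->//|[n /key ->]] := piece_or_bot Lx x0.
by rewrite /endpoint.
Qed.

(** * Transporting the kernel to one piece *)

(** No jump is indexed by a point of the Cantor set, but there are jumps in each of its
    gaps. *)
Hypothesis B_off_cset : forall b, B b -> exists n, forall s : seq bool, size s = n -> ~ cseg s b.
Hypothesis B_mid : forall s : seq bool, exists b, B b /\
  cleft R s + clen R s / 3 < b < cleft R s + 2 * (clen R s / 3).

Definition mid (s : seq bool) : R := projT1 (cid (B_mid s)).

Lemma B_mids (s : seq bool) : B (mid s).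
Proof. exact: (projT2 (cid (B_mid s))).1. Qed.

Lemma mid_itv (s : seq bool) : cleft R s + clen R s / 3 < mid s < cleft R s + 2 * (clen R s / 3).
Proof. exact: (projT2 (cid (B_mid s))).2. Qed.

Let tip_exists (s : seq bool) : exists y, L y /\ forall b, B b -> (lo b < y)%O <-> b < cleft R s.
Proof.
by apply: (@cut_exists [set b | b < cleft R s]) => b c _ _ cb /=; exact: lt_trans.
Qed.

(** The point of the Cantor set that is the left end of the segment [s], as a cut. *)
Definition tip (s : seq bool) : K := projT1 (cid (tip_exists s)).

Lemma L_tip (s : seq bool) : L (tip s).
Proof. exact: (projT2 (cid (tip_exists s))).1. Qed.

Lemma tip_cut (s : seq bool) b : B b -> (lo b < tip s)%O = (b < cleft R s).
Proof. by move=> Bb; apply/idP/idP => /((projT2 (cid (tip_exists s))).2 b Bb). Qed.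

Lemma tip_piece0 (s : seq bool) : piece 0 (tip s).
Proof.
have := cseg_bound (cseg_left R s); rewrite /piece !tip_cut// -[(0 + 1)%:~R]/(1 : R).
by rewrite -[0%:~R]/(0 : R) -leNgt; lra.
Qed.

(** A point of [L] turns right at a node of the tree if it is to the right of the jump
    chosen in the middle third of this node. *)
Fixpoint route w n : seq bool :=
  if n is m.+1 then (lo (mid (route w m)) < w)%O :: route w m else [::].

Definition turn w n : bool := (lo (mid (route w n)) < w)%O.

Lemma prefix_turn w n : prefix_of (turn w) n = route w n.
Proof. by elim: n => //= n ->. Qed.

Lemma size_route w n : size (route w n) = n.
Proof. by rewrite -prefix_turn size_prefix_of. Qed.

Lemma route_tip (t s : seq bool) : route (tip (t ++ s)) (size s) = s.
Proof.
elim: s t => //= b s IH t; have := IH (rcons t b); rewrite cat_rcons => ->.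
congr (_ :: _); rewrite tip_cut; last exact: B_mids.
have := mid_itv s; have := clen_gt0 R s; have := cseg_cat (cseg_left R (t ++ b :: s)).
rewrite /cseg /mkset clen_cons cleft_cons.
case: b => /= h1 h2 h3; first lra.
by apply/negbTE; rewrite -leNgt; lra.
Qed.

Lemma route_regular n : exists s, (forall b, b \in s -> B b) /\
  forall x y, agree s x y -> route x n = route y n.
Proof.
elim: n => [|n [s [Bs hs]]]; first by exists [::].
exists (s ++ [seq mid (val t) | t <- enum {: n.-tuple bool}]); split.
  by move=> b; rewrite mem_cat => /orP[/Bs//|/mapP[t _ ->]]; exact: B_mids.
move=> x y ag /=; have <- : route x n = route y n.
  by apply: hs => b bs; apply: ag; rewrite mem_cat bs.
congr (_ :: _); apply: ag; rewrite mem_cat; apply/orP; right.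
have sz : size (route x n) == n by rewrite size_route.
by apply/mapP; exists (Tuple sz); rewrite ?mem_enum.
Qed.

(** Each of the finitely many jumps at which [F] varies by more than [e] avoids the
    segments of a sufficiently late generation, so it does not separate the
    tips of the descendants of such a segment. *)
Lemma tip_cauchy F : regular F -> tree_cauchy (F \o tip).
Proof.
move=> rF e e0; have [s [Bs hs]] := rF e e0.
have [N hN] : exists N, forall r, (N <= size r)%N -> forall b, b \in s -> ~ cseg r b.
  elim: s Bs {hs} => [|b s IH] Bs; first by exists 0%N.
  have [|N hN] := IH; first by move=> c cs; apply: Bs; rewrite inE cs orbT.
  have [M hM] := B_off_cset (Bs b (mem_head _ _)).
  exists (maxn N M) => r; rewrite geq_max => /andP[Nr Mr] c.
  rewrite inE => /orP[/eqP ->|]; last exact: hN.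
  rewrite -(cat_take_drop (size r - M) r) => /cseg_cat; apply: hM.
  by rewrite size_drop subKn.
exists N => r Nr t; apply: hs; try exact: L_tip.
move=> b bs; rewrite !tip_cut ?Bs//; try exact: Bs.
have := hN r Nr b bs; have := @cseg_cat R t r _ (cseg_left R _).
rewrite /cseg /= => /andP[h1 h2] h3.
have [bl|lb] := ltP b (cleft R r); first by rewrite (lt_le_trans bl h1).
apply/negbTE; rewrite -leNgt; apply: le_trans h2 _.
by rewrite leNgt; apply/negP => h; apply: h3; rewrite lb ltW.
Qed.

Variable u : nat -> K -> R^o.
Hypothesis cu : forall n, continuous (u n).
Hypothesis u_sep : forall v : C, (forall n, analysis v n = 0) ->
  forall x y, unseparated u x y -> unseparated u y x -> v x = v y.

(** The point of [K] reached in the tree of closed sets by the turns of [w]. *)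
Definition landing w : K := branch_point cK (lo 0%:~R) cu (turn w).

Lemma landingP w n : node u (route w n) (landing w).
Proof. by rewrite -prefix_turn; exact: branch_pointP. Qed.

Definition lift (v : K -> R) w : R := if piece 0 w then v (landing w) else 0.

Definition embed (v : C) : C := to_C (ext (lift v)).

Definition average (g : C) : C := to_C (mean u (g \o tip)).

Lemma lift_regular (v : C) : (forall n, analysis v n = 0) -> regular (lift v).
Proof.
move=> v0 e e0.
have [N hN] := node_small_osc cK (lo 0%:~R) cu (@cfun_continuous _ _ v) (u_sep v0) e0.
have [s [Bs hs]] := route_regular N.
exists (0%:~R :: (0 + 1)%:~R :: s); split.
  by move=> b; rewrite !inE => /or3P[/eqP ->|/eqP ->|/Bs].
move=> x y _ _ ag; rewrite /lift (@piece_agree 0 x y _ _ _ ag) ?inE ?eqxx ?orbT//.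
case: ifP => _; last by rewrite subrr normr0 ltW.
have e' : route x N = route y N.
  by apply: hs => b bs; apply: ag; rewrite !inE bs !orbT.
apply: (hN (route x N)); [exact: size_route|exact: landingP|].
by rewrite e'; exact: landingP.
Qed.

Lemma averageE (g : C) x : average g x = mean u (g \o tip) x.
Proof. by apply: to_CE; apply: mean_continuous => //; exact/tip_cauchy/C_regular. Qed.

(** At the tip of [s] the transported function takes a value of [v] in the node [s], so the
    mean of these values is [v] by [mean_exact]. *)
Lemma average_embed (v : C) : (forall n, analysis v n = 0) -> average (embed v) = v.
Proof.
move=> v0; apply: C_eq => x; rewrite averageE.
apply: (mean_exact cK (lo 0%:~R) cu x (@cfun_continuous _ _ v) (u_sep v0)).
  exact/tip_cauchy/C_regular.
move=> s; exists (landing (tip s)).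
  by rewrite -[X in node u X](route_tip [::] s) cat0s; exact: landingP.
rewrite /= /embed to_CE; last exact/ext_continuous/lift_regular.
by rewrite ext_on ?/lift ?tip_piece0//; exact: L_tip.
Qed.

Lemma average_lin (k : R) f g : average (k *: f + g) = k *: average f + average g.
Proof.
apply: C_eq => x; rewrite -[RHS]/(k * average f x + average g x) !averageE.
have gc (h : C) : tree_cauchy (h \o tip) := tip_cauchy (C_regular h).
by rewrite -(mean_lin u x (gc f) (gc g) (gc (k *: f + g))).
Qed.

Lemma average_bound g : `|average g| <= `|g|.
Proof.
apply: norm_C_le => // x; rewrite averageE; apply: mean_bound.
  exact/tip_cauchy/C_regular.
by move=> s; exact: norm_C_ub.
Qed.

Let S0 : synthesis (fun=> 0) = 0.
Proof.
apply: C_eq => x; rewrite synthesisE; last first.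
  split => [n y|e e0]; last by exists 0%N => n _; rewrite normr0 ltW.
  rewrite -[LHS]/(0 : R) -(ext_cst 0 y); apply: ext_eq => z _.
  by rewrite /on_piece0; case: ifP.
rewrite -[RHS]/(0 : R) -(ext_cst 0 x); apply: ext_eq => z _.
by apply: (glueP (P := fun r => r = 0)).
Qed.

Let kernel_part f : C := f - synthesis (analysis f).

Let analysis_sub f g n : analysis (f - g) n = analysis f n - analysis g n.
Proof. by have := analysis_lin (-1) g f n; rewrite !scaleN1r addrC => ->; rewrite addrC. Qed.

Let kernel_partP f n : analysis (kernel_part f) n = 0.
Proof. by rewrite analysis_sub synthesisK ?subrr//; exact: analysis_null. Qed.

Let kernel_part_lin (k : R) f g : kernel_part (k *: f + g) = k *: kernel_part f + kernel_part g.
Proof.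
rewrite /kernel_part (_ : analysis (k *: f + g) = fun n => k *: analysis f n + analysis g n).
  rewrite (synthesis_lin k (analysis_null f) (analysis_null g)).
  by rewrite scalerBr opprD addrACA.
by apply/funext => n; exact: analysis_lin.
Qed.

Let kernel_part_bound f : `|kernel_part f| <= 3 * `|f|.
Proof.
have := ler_normB f (synthesis (analysis f)).
have := synthesis_bound (analysis_null f) (analysis_bound f).
by rewrite -/(kernel_part f); lra.
Qed.

Let kernel_part_id v : (forall n, analysis v n = 0) -> kernel_part v = v.
Proof.
move=> v0; rewrite /kernel_part (_ : analysis v = fun=> 0) ?S0 ?subr0//.
exact/funext.
Qed.

Let embed_lin (k : R) f g : (forall n, analysis f n = 0) -> (forall n, analysis g n = 0) ->
  embed (k *: f + g) = k *: embed f + embed g.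
Proof.
move=> f0 g0; have fg0 n : analysis (k *: f + g) n = 0.
  by rewrite analysis_lin f0 g0 scaler0 addr0.
apply: C_eq => x; rewrite -[RHS]/(k * embed f x + embed g x) /embed.
rewrite !to_CE; try exact/ext_continuous/lift_regular.
rewrite -ext_lin; apply: ext_eq => z _; rewrite /lift; case: ifP => // _.
by rewrite mulr0 addr0.
Qed.

Let embed_bound v : (forall n, analysis v n = 0) -> `|embed v| <= `|v|.
Proof.
move=> v0; apply: norm_C_le => // x; rewrite /embed to_CE.
  apply: ext_bound => z _; rewrite /lift; case: ifP => _; first exact: norm_C_ub.
  by rewrite normr0.
exact/ext_continuous/lift_regular.
Qed.

(** The projection [kernel_part] makes [embed] defined on the whole space, and
    corrects averages so that they lie in the kernel. *)
Lemma charted_square : banach_isomorphic C (C * C)%type.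
Proof.
apply: (@banach_square R C C piece0_space 3 _ _ analysis synthesis (embed \o kernel_part)
  (kernel_part \o average)).
- by rewrite ler1n.
- by move=> k f g; exact: piece0_space_lin.
- exact: analysis_null.
- exact: analysis_lin.
- by move=> f n; rewrite (le_trans (analysis_bound f n))// ler_wpM2r// ler_nat.
- exact: synthesis_lin.
- move=> y M ny yM; rewrite (le_trans (synthesis_bound ny yM))// ler_peMl ?ler1n//.
  exact: le_trans (yM 0%N).
- exact: synthesisK.
- move=> f; apply: piece0_spaceP => [|x _ /negbTE p0]; last by rewrite /lift p0.
  exact/lift_regular/kernel_partP.
- by move=> k f g /=; rewrite kernel_part_lin embed_lin//; exact: kernel_partP.
- move=> f /=; exact: le_trans (embed_bound (kernel_partP f)) (kernel_part_bound f).
- by move=> k f g _ _ /=; rewrite average_lin kernel_part_lin.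
- move=> f _ /=; rewrite (le_trans (kernel_part_bound _))// ler_wpM2l//.
  exact: average_bound.
- by move=> w n _; exact: kernel_partP.
- by move=> v v0 /=; rewrite (kernel_part_id v0) average_embed// kernel_part_id.
Qed.

End ChartedLine.

(** * The theorem *)

Theorem corollary1p4 (R : realType) (hBA : Baumgartner_axiom R)
    (d : Order.disp_t) (K : orderTopologicalType d)
    (cK : compact [set: K]) (sK : separable K) (wK : weight_omega1 K) :
  banach_isomorphic (Cspace R cK) (Cspace R cK * Cspace R cK)%type.
Proof.
have [B0 [lo [hi [B0d jL lo_lt zdL]]]] := core_chart cK sK wK hBA.
have [D [cD dD]] := sK.
have P0 : periodic B0 0%:~R by exact: periodic_int.
(* A function in the kernel of the analysis is constant on each half of the core, so its
   jumps are of the last two kinds: those that touch the complement of the core, and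
   the jump with index 0, which separates the halves. *)
pose E : set (K * K) := [set p | (p.1 < p.2)%O /\ ((D `*` D) p \/
  (jump_in setT p.1 p.2 /\ ~ (core p.1 /\ core p.2)) \/ p = (lo 0%:~R, hi 0%:~R))].
have cE : countable E.
  pose J := [set p : K * K | jump_in setT p.1 p.2 /\ ~ (core p.1 /\ core p.2)].
  apply: (@countableS _ _ ((D `*` D) `|` J `|` [set (lo 0%:~R, hi 0%:~R)])).
    by move=> p [_ [?|[?|?]]]; [left; left|left; right|right].
  apply: countableU => //; apply: countableU; first exact: countableX.
  have /countable_injP[g gI] := countable_jumps_touching_off_core cK cD dD.
  apply/countable_injP; exists (g \o fst) => -[x y] [x' y']; rewrite !inE /J /= => -[j nj] [j' nj'].
  move=> /gI; rewrite !inE => e; have {}e : x = x' by apply: e; [exists y|exists y'].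
  by rewrite -e in j' *; rewrite (jump_in_inj j j').
have E0 : E (lo 0%:~R, hi 0%:~R).
  by split; [have [_ _] := jL _ P0|right; right].
have [q [qE Eq]] := countable_enum cE E0.
have /choice[w wP] : forall p : K * K, exists w : K -> R^o, continuous w /\
    ((p.1 < p.2)%O -> (forall z, (z <= p.1)%O -> w z < 1) /\
      forall z, (p.2 <= z)%O -> 2 < w z).
  move=> p; have [lt|nlt] := boolP (p.1 < p.2)%O; last first.
    by exists (fun=> 0); split => // x; exact: cvg_cst.
  have [f [cf _ f0 f1]] := line_normal cK R lt; exists (fun z => 3 * f z); split.
    by move=> x; apply: cvgM; [exact: cvg_cst|exact: cf].
  by move=> _; split => z hz; [rewrite f0//; lra|rewrite f1//; lra].
pose u n := w (q n); have cu n : continuous (u n) by exact: (wP (q n)).1.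
have sep p x y : E p -> (x <= p.1)%O -> (p.2 <= y)%O -> ~ unseparated u x y.
  move=> Ep xp py /[dup] h; have [n qn] := Eq p Ep; move=> /(_ n); apply.
  by have [_ /(_ Ep.1)[h1 h2]] := wP p; rewrite /u qn; split; [exact: h1|exact: h2].
have B_shift b (k : int) : periodic B0 b -> periodic B0 (b + k%:~R) by exact: periodicD.
apply: (@charted_square R d K cK core (periodic B0) lo hi (core_closed (K := K))
  jL lo_lt zdL (periodic_int B0) B_shift _ _ u cu).
- move=> b [_ nP]; apply: contrapT => H; apply: (nP 0); rewrite subr0 => n.
  apply: contrapT => H'; apply: H; exists n => s sn bs; apply: H'; by exists s.
- move=> s; have l0 := clen_gt0 R s.
  have := periodic_uncountable B0d
    (itv_open (cleft R s + clen R s / 3) (cleft R s + 2 * (clen R s / 3))).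
  have ne : `]cleft R s + clen R s / 3, (cleft R s + 2 * (clen R s / 3))[%classic !=set0.
    by exists (cleft R s + clen R s / 2); rewrite /= in_itv/=; lra.
  move=> /(_ ne) nc; apply: contrapT => H; apply: nc.
  apply: countableS (countable0 R) => b [/=]; rewrite in_itv/= => hb Bb.
  by apply: H; exists b.
move=> v v0 x y xy yx.
wlog lt : x y xy yx / (x < y)%O.
  move=> W; have [lt|lt|->//] := ltgtP x y; first exact: W.
  by apply/esym; exact: W.
have jumpv z z' : jump_in setT z z' -> (x <= z)%O -> (z' <= y)%O -> v z = v z'.
  move=> [_ _ zz' H] xz z'y.
  have nE : ~ E (z, z') by move=> /sep/(_ xz z'y); apply.
  have [cz cz'] : core z /\ core z'.
    by apply: contrapT => nc; apply: nE; split => //; right; left.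
  rewrite (analysis_ker zdL v0 cz) (analysis_ker zdL v0 cz').
  suff -> : (lo 0%:~R < z)%O = (lo 0%:~R < z')%O by [].
  apply/idP/idP => [/lt_trans|lz']; first exact.
  rewrite ltNge; apply/negP => zl; apply: nE; split => //; right; right.
  have [cl ch lh jl] := jL _ P0; congr (_, _).
    by apply/eqP; rewrite eq_le zl leNgt; apply/negP => /(H _ I); rewrite leNgt lz'.
  apply/eqP; rewrite eq_le (H _ I) ?(le_lt_trans zl lh)//=.
  exact: jl.
have nothing a b : (a < b)%O -> ~ (exists z, (a < z < b)%O) -> jump_in setT a b.
  move=> ab H; split => // z _ az; rewrite leNgt; apply/negP => zb.
  by apply: H; exists z; rewrite az.
(* Two points of [D] between [x] and [y] would separate them, so at most two points
   of [K] lie between and the value of [v] is followed across at most three jumps. *)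
have three a b c : (x < a)%O -> (a < b)%O -> (b < c)%O -> ~ (c < y)%O.
  move=> xa ab bc cy.
  have [t Dt /andP[xt tb]] := dense_itv dD xa ab.
  have [t' Dt' /andP[bt' t'y]] := dense_itv dD bc cy.
  apply: (sep (t, t') x y _ (ltW xt) (ltW t'y) xy).
  by split => /=; [exact: lt_trans tb bt'|left].
have [[m /andP[xm my]]|H] := pselect (exists z, (x < z < y)%O); last first.
  by apply: jumpv; rewrite ?lexx//; exact: nothing.
have [[m' /andP[xm' m'm]]|H] := pselect (exists z, (x < z < m)%O).
  rewrite (jumpv x m') ?lexx ?(ltW (lt_trans m'm my))//; last first.
    by apply: nothing => // -[z /andP[xz zm']]; exact: (three z m' m).
  rewrite (jumpv m' m) ?(ltW xm') ?(ltW my)//; last first.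
    by apply: nothing => // -[z /andP[xz zm']]; exact: (three m' z m).
  rewrite (jumpv m y) ?(ltW xm)//.
  by apply: nothing => // -[z /andP[xz zm']]; exact: (three m' m z).
rewrite (jumpv x m) ?lexx ?(ltW my)//; last exact: nothing.
have [[m' /andP[mm' m'y]]|H'] := pselect (exists z, (m < z < y)%O); last first.
  by apply: jumpv; rewrite ?lexx ?(ltW xm)//; exact: nothing.
rewrite (jumpv m m') ?(ltW xm) ?(ltW m'y)//; last first.
  by apply: nothing => // -[z /andP[xz zm']]; exact: (three m z m').
rewrite (jumpv m' y) ?(ltW (lt_trans xm mm'))//.
by apply: nothing => // -[z /andP[xz zm']]; exact: (three m m' z).
Qed.
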